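(* Let $\mathcal{F}$ be a foliation on a manifold $M$, and for $r\ge 1$ let $\mathcal{F}^{r}$ be the lifted foliation on the bundle $\mathcal{J}^{r}=\mathcal{J}^{r}\nu\mathcal{F}$ of $r$-jets of foliated sections of the normal bundle $\nu\mathcal{F}$. Then there exists $r\geq 1$ such that $\mathcal{F}^{r}$ is riemannian if and only if $\mathcal{F}$ is riemannian.
   Context: Let $M$ be an $n$-dimensional manifold with a $k$-dimensional foliation $\mathcal{F}$; $\tau F\subset TM$ is the tangent plane field of $\mathcal{F}$ and $\nu\mathcal{F}=\nu F=TM/\tau F$ its normal bundle. A function on $M$ is basic if it is locally constant along the leaves. A bundle $p:E\to M$ is foliated if it has an atlas of local trivializations such that all components of the structural (transition) functions are basic. Then $E$ carries a canonical foliation $\mathcal{F}_E$ of the same dimension $k$, such that $p$ restricted to the leaves is a local diffeomorphism onto leaves of $\mathcal{F}$: if $(u,x)$ are foliated coordinates on $M$ ($u$ along the leaves, $x$ transverse) and $y$ are fiber coordinates from a foliated trivialization, the leaves are locally given by $x=\mathrm{const}$, $y=\mathrm{const}$. The normal bundle $\nu\mathcal{F}$ is a foliated vector bundle (with trivializations given by the classes of $\partial/\partial x^i$). A local section is foliated if its components in foliated trivializations are basic. For a foliated vector bundle $E$ and $r\ge1$, $\mathcal{J}^rE\to M$ is the bundle of $r$-jets of foliated local sections of $E$ (equivalence classes of foliated local sections at points of $M$, the relation being coincidence up to order $r$); local coordinates are $(u,x)$, $y$, and the partial derivatives of $y$ with respect to $x$ up to order $r$. It is again a foliated vector bundle over $M$,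 so its total space carries the lifted foliation $\mathcal{F}^r_E$. For $E=\nu\mathcal{F}$ one writes $\mathcal{J}^r=\mathcal{J}^r\nu\mathcal{F}$ and $\mathcal{F}^r$ for the lifted foliation. A foliation is riemannian if its normal bundle admits a holonomy invariant (i.e. foliated) riemannian metric: a positive definite fiber metric whose components in foliated trivializations are basic functions. *)

(* Defs.v *)
From HB Require Import structures.
From mathcomp Require Import all_boot all_order all_algebra.
From mathcomp Require Import all_classical all_reals all_analysis.

Set Implicit Arguments.
Unset Strict Implicit.
Unset Printing Implicit Defensive.

Import Order.TTheory GRing.Theory Num.Theory.
Import numFieldNormedType.Exports.

Local Open Scope classical_set_scope.
Local Open Scope ring_scope.

Section SmoothMaps.
Context {R : realType} {V W : normedModType R}.

(* [f] is of class C^n at every point of [A]; meant for [A] open. *)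
Fixpoint Ck_on (n : nat) (A : set V) (f : V -> W) : Prop :=
  match n with
  | 0 => forall x, A x -> {for x, continuous f}
  | n'.+1 => (forall x, A x -> differentiable f x) /\
             forall v : V, Ck_on n' A ('D_v f)
  end.

Definition smooth_on (A : set V) (f : V -> W) : Prop := forall n, Ck_on n A f.

End SmoothMaps.

Record chart (R : realType) (M : Type) (n : nat) := Chart {
  cdom : set M ;
  cmap :> M -> 'rV[R]_n }.

(* [read c f] is [f \o c^-1] on the image of the chart domain, and 0 outside. *)
Definition read (R : realType) (M : Type) (n : nat) (W : zmodType)
    (c : chart R M n) (f : M -> W) : 'rV[R]_n -> W :=
  fun z => if pselect (exists p, cdom c p /\ c p = z) is left H
           then f (projT1 (cid H)) else 0.

Record atlas (R : realType) (M : Type) (n : nat) := Atlas {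
  aidx : Type ;
  achart :> aidx -> chart R M n }.

Section Manifolds.
Context {R : realType} {M : topologicalType} {n : nat}.
Implicit Types (c d : chart R M n) (A F : atlas R M n).

Lemma readE (W : zmodType) c (f : M -> W) p :
  set_inj (cdom c) c -> cdom c p -> read c f (c p) = f p.
Proof.
move=> ci cp; rewrite /read; case: pselect => [H|[]]; last by exists p.
case: (cid H) => p' [cp' e] /=.
by congr f; apply: ci => //; rewrite inE.
Qed.

(* A homeomorphism of an open subset of [M] onto an open subset of R^n. *)
Definition is_chart c : Prop :=
  [/\ open (cdom c), set_inj (cdom c) c,
      (forall p, cdom c p -> {for p, continuous c}) &
      (forall V : set M, open V -> V `<=` cdom c -> open (c @` V))].

Definition smooth_in_chart (W : normedModType R) c (V : set M) (f : M -> W) :=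
  smooth_on (c @` (V `&` cdom c)) (read c f).

Definition smooth_transition c d : Prop := smooth_in_chart c (cdom d) d.

Definition smooth_atlas A : Prop :=
  [/\ (forall i, is_chart (A i)),
      (forall p, exists i, cdom (A i) p) &
      (forall i j, smooth_transition (A i) (A j))].

Definition smooth_manifold A : Prop :=
  [/\ hausdorff_space M, @second_countable M & smooth_atlas A].

Definition compatible A F : Prop := forall i j,
  smooth_transition (A i) (F j) /\ smooth_transition (F j) (A i).

End Manifolds.

(* The coordinates of a foliated chart are [row_mx u x]: [u] in R^k along the
   leaves and [x] in R^q transverse to them. *)
Definition fatlas (R : realType) (M : Type) (k q : nat) := atlas R M (k + q).

Section Foliations.
Context {R : realType} {M : topologicalType} {k q : nat}.
Implicit Types (F : fatlas R M k q).

Definition xcoord F (i : aidx F) (p : M) : 'rV[R]_q := rsubmx (F i p).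

(* Locally constant along the leaves: near [p], the leaf of [p] is
   the plaque [x = const] of any foliated chart around [p]. *)
Definition basic_on F (T : Type) (V : set M) (f : M -> T) : Prop :=
  forall i p, V p -> cdom (F i) p ->
    \forall p' \near p,
      cdom (F i) p' -> xcoord i p' = xcoord i p -> f p' = f p.

Definition fsmooth_on F (W : normedModType R) (V : set M) (f : M -> W) : Prop :=
  forall i, smooth_in_chart (F i) V f.

(* A [k]-dimensional foliation of the manifold with atlas [A], given by
   foliated charts of that manifold. *)
Definition foliation (A : atlas R M (k + q)) F : Prop :=
  [/\ smooth_atlas F, compatible A F &
      forall j, basic_on F (cdom (F j)) (xcoord j)].

End Foliations.

(* A vector bundle of rank [m] over a foliated manifold, with one
   trivialization over each foliated chart domain; [triv i p] is relevant for
   [p] in that domain only.  The linear and smooth structures are those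
   transported by the trivializations.  The record carries no laws: the two
   instances below, the normal bundle and its jet bundles, satisfy them as
   soon as [F] is a foliation. *)
Record fbundle (R : realType) (M : Type) (k q : nat) (F : fatlas R M k q)
    (m : nat) := FBundle {
  fiber : M -> Type ;
  triv : forall (i : aidx F) (p : M), fiber p -> 'rV[R]_m }.

Section NormalBundle.
Context {R : realType} {M : topologicalType} {k q : nat} (F : fatlas R M k q).

(* A tangent vector is the family of its components in all the charts around
   its base point. *)
Definition tangent_space (p : M) : Type :=
  {v : aidx F -> 'rV[R]_(k + q) |
    (forall i j, cdom (F i) p -> cdom (F j) p ->
       v j = 'd (read (F i) (F j)) (F i p) (v i)) /\
    (forall i, ~ cdom (F i) p -> v i = 0)}.

(* The tangent plane of the foliation, spanned by the d/du. *)
Definition tauF (p : M) : set (tangent_space p) :=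
  [set t | forall i, cdom (F i) p -> rsubmx (sval t i) = 0].

Definition tau_coset (p : M) (v : tangent_space p) : set (tangent_space p) :=
  [set w | exists2 t : tangent_space p, tauF t &
     forall i, sval w i = sval v i + sval t i].

Definition normal_fiber (p : M) : Type :=
  {C : set (tangent_space p) | exists v, C = tau_coset v}.

Definition normal_triv (i : aidx F) (p : M) (C : normal_fiber p) : 'rV[R]_q :=
  rsubmx (sval (projT1 (cid (svalP C))) i).

Definition normal_bundle : fbundle F q := FBundle normal_triv.

End NormalBundle.

Section JetBundle.
Context {R : realType} {M : topologicalType} {k q : nat} {F : fatlas R M k q}.
Context {m : nat} (E : fbundle F m).

Definition component (i : aidx F) (s : forall p, fiber E p) : M -> 'rV[R]_m :=
  fun p => triv i (s p).

Definition foliated_section (V : set M) (s : forall p, fiber E p) : Prop :=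
  forall i, fsmooth_on F (V `&` cdom (F i)) (component i s) /\
            basic_on F (V `&` cdom (F i)) (component i s).

(* A local section is a global choice of fiber elements of which only the
   values near [p] matter. *)
Definition foliated_near (p : M) (s : forall p, fiber E p) : Prop :=
  exists V : set M, [/\ open V, V p & foliated_section V s].

Variable r : nat.

Definition multi_index : Type :=
  {a : {ffun 'I_q -> 'I_r.+1} | (\sum_(b < q) a b <= r)%N}.
HB.instance Definition _ := Finite.on multi_index.

Definition xdir (b : 'I_q) : 'rV[R]_(k + q) := row_mx 0 (delta_mx 0 b).

Definition partial_x (a : multi_index) (f : 'rV[R]_(k + q) -> 'rV[R]_m) :=
  foldr (fun b g => iter (sval a b) (fun h => 'D_(xdir b) h) g) f (enum 'I_q).

Definition xderiv (i : aidx F) (a : multi_index) (s : forall p, fiber E p)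
    (p : M) : 'rV[R]_m :=
  partial_x a (read (F i) (component i s)) (F i p).

Definition same_jet (p : M) (s t : forall p, fiber E p) : Prop :=
  forall i, cdom (F i) p -> forall a, xderiv i a s p = xderiv i a t p.

Definition jet_class (p : M) (s : forall p, fiber E p) :
    set (forall p, fiber E p) :=
  [set t | foliated_near p t /\ same_jet p s t].

Definition jet_fiber (p : M) : Type :=
  {C : set (forall p, fiber E p) |
    exists s, foliated_near p s /\ C = jet_class p s}.

Definition jet_index : finType := (multi_index * 'I_m)%type.

Definition jet_triv (i : aidx F) (p : M) (C : jet_fiber p) :
    'rV[R]_#|{: jet_index}| :=
  let s := projT1 (cid (svalP C)) in
  \row_l (xderiv i (enum_val l).1 s p 0 (enum_val l).2).

Definition jet_bundle : fbundle F #|{: jet_index}| := FBundle jet_triv.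

End JetBundle.

Section TotalSpace.
Context {R : realType} {M : topologicalType} {k q : nat} {F : fatlas R M k q}.
Context {m : nat} (E : fbundle F m).

Definition total_space : Type := {p : M & fiber E p}.

(* Coordinates (u, (x, y)), [y] being the fiber coordinates. *)
Definition lifted_chart (i : aidx F) : chart R total_space (k + (q + m)) :=
  {| cdom := [set w : total_space | cdom (F i) (projT1 w)] ;
     cmap := fun w : total_space =>
       row_mx (lsubmx (F i (projT1 w)))
              (row_mx (rsubmx (F i (projT1 w))) (triv i (projT2 w))) |}.

(* The leaves of the lifted foliation are locally x = const, y = const. *)
Definition lifted_foliation : fatlas R total_space k (q + m) :=
  Atlas lifted_chart.

(* The topology of the total space is the one of its charts. *)
Definition total_open (U : set total_space) : Prop :=
  forall i w, U w -> cdom (lifted_chart i) w ->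
    \forall z \near lifted_chart i w,
      forall w', cdom (lifted_chart i) w' -> lifted_chart i w' = z -> U w'.

Lemma total_openT : total_open setT.
Proof. by move=> i w _ _; near=> z. Unshelve. all: by end_near. Qed.

Lemma total_openI : setI_closed total_open.
Proof.
move=> U V oU oV i w [Uw Vw] iw.
near=> z => w' iw' e; split.
- exact: (near (oU i w Uw iw) z).
- exact: (near (oV i w Vw iw) z).
Unshelve. all: by end_near. Qed.

Lemma total_open_bigU (I : Type) (f : I -> set total_space) :
  (forall i, total_open (f i)) -> total_open (\bigcup_i f i).
Proof.
move=> of_ i w [l _ flw] iw.
near=> z => w' iw' e; exists l => //.
exact: (near (of_ l i w flw iw) z).
Unshelve. all: by end_near. Qed.

HB.instance Definition _ := gen_eqMixin total_space.
HB.instance Definition _ := gen_choiceMixin total_space.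
HB.instance Definition _ :=
  @isOpenTopological.Build total_space total_open total_openT total_openI
    total_open_bigU.

End TotalSpace.

Section Riemannian.
Context {R : realType} {M : topologicalType} {k q : nat}.

(* [g] is a positive definite fiber metric on [E] whose matrix [G] in each
   foliated trivialization is smooth and basic. *)
Definition foliated_metric (F : fatlas R M k q) (m : nat) (E : fbundle F m)
    (g : forall p, fiber E p -> fiber E p -> R) : Prop :=
  forall i : aidx F, exists G : M -> 'M[R]_m,
    [/\ fsmooth_on F (cdom (F i)) G,
        basic_on F (cdom (F i)) G &
        forall p, cdom (F i) p ->
          [/\ (G p)^T = G p,
              (forall y : 'rV[R]_m, y != 0 -> 0 < (y *m G p *m y^T) 0 0) &
              forall a b : fiber E p,
                g p a b = (triv i a *m G p *m (triv i b)^T) 0 0]].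

Definition riemannian (F : fatlas R M k q) : Prop :=
  exists g, @foliated_metric F q (normal_bundle F) g.

End Riemannian.

(* Main.v *)
Require Import Defs.
From HB Require Import structures.
From mathcomp Require Import all_boot all_order all_algebra.
From mathcomp Require Import all_classical all_reals all_analysis.
From mathcomp Require Import ring.

Set Implicit Arguments.
Unset Strict Implicit.
Unset Printing Implicit Defensive.

Import Order.TTheory GRing.Theory Num.Theory.
Import numFieldNormedType.Exports.

(** A transverse metric on the total space of the jet bundle restricts to one
    on the base along the zero section; conversely a transverse metric on the
    base has a Levi-Civita connection, hence a Sasaki metric on the bundle of
    1-jets, and everything in its construction is holonomy invariant because it
    is natural.

    All of this is done in the coordinates [row_mx u x] of foliated charts. A
    smooth function is called basic there when its derivatives along [u] vanish
    ([basic_smooth]). This infinitesimal condition survives sums, products,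
    inverses, transition maps and, as second derivatives commute, differentiation
    ([basic_smooth_derive]); the mean value theorem turns it back into local
    constancy along the plaques ([basic_smooth_locally_constant]). A transverse
    metric then amounts to basic matrices [H i] that are positive definite and
    satisfy [H i = J *m H j *m J^T], where [J] is the transverse Jacobian of the
    transition map ([riemannianP]).

    The axioms of a foliated vector bundle are isolated in [foliated_bundle].
    The normal bundle satisfies them, with [J] as change of trivialization. So
    do the jet bundles of a foliated bundle ([jet_bundle_foliated]): by the
    chain rule the derivatives in one chart are combinations, with basic
    coefficients, of those in another, and polynomials have arbitrary jets. The
    total space of a foliated bundle is again a foliated manifold
    ([lifted_foliated_atlas]), so that the characterization of transverse
    metrics applies to it as well.

    The zero section is transverse to the fibers and compatible with the
    foliations. The block of a metric matrix of the total space that belongs to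
    the base, taken along the zero section, is therefore a transverse metric of
    the base; this holds for every foliated bundle, in particular for jets of any order
    ([riemannian_of_lifted]).

    For the converse the order 1 suffices. The Levi-Civita connection [Gamma] of
    a transverse metric is basic, and transforms under transition maps as a
    connection does since it is determined by its symmetry and its
    compatibility with the metric ([symmetric_family_unique],
    [christoffel_transition]). A 1-jet with value [X] and slope [Y] defines the
    endomorphism [A = Y + Gamma X], the covariant derivative of any vector field
    with this jet, so that [X] and [A] are tensors. A tangent vector of the jet
    space modulo the leaves has a projection to the base and covariant
    differentials of [X] and [A]; the sum of their squared norms is positive
    definite ([sasaki_spd]) and independent of the chart
    ([sasaki_transition]). *)

Local Open Scope classical_set_scope.
Local Open Scope ring_scope.

(** * Smooth functions on open sets *)

Lemma open_near (T : topologicalType) (A : set T) x : open A -> A x -> \near x, A x.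
Proof. by move=> oA Ax; exact: open_nbhs_nbhs. Qed.

Section Locality.
Context {R : realType} {V W : normedModType R}.
Implicit Types (f g : V -> W) (A : set V).

Lemma near_eq_differentiable f g x :
  (\near x, f x = g x) -> differentiable f x -> differentiable g x.
Proof.
move=> fg df.
have fgx : f x = g x := nbhs_singleton fg.
have [cdf edf] := (diff_locallyP _ _).1 df.
have e : g \o shift x = cst (g x) + 'd f x +o_ (0 : V) id.
  apply/eqaddoP => _/posnumP[e].
  move/eqaddoP : edf => /(_ e%:num (gt0 e)) => edf.
  have fg0 : \forall y \near 0, f (y + x) = g (y + x).
    by rewrite (near_shift x) /= sub0r; near do rewrite /= subrK//.
  near=> y.
  have -> : (g \o shift x - (cst (g x) + 'd f x)) y =
            (f \o shift x - (cst (f x) + 'd f x)) y.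
    by rewrite !fctE /= fgx (near fg0 y)//.
  by near: y.
have dg := diff_unique cdf e.
by apply/diff_locallyP; rewrite dg.
Unshelve. all: by end_near. Qed.

Lemma Ck_on_ext n A f g : open A -> (forall x, A x -> f x = g x) ->
  Ck_on n A f -> Ck_on n A g.
Proof.
move=> oA; elim: n f g => [|n IH] f g fg /=.
  move=> cf x Ax; have fgx : \forall y \near x, f y = g y.
    by near=> y; apply: fg; near: y; exact: open_near.
  suff : g @ x --> g x by [].
  rewrite -(fg x Ax); apply: cvg_trans (cf x Ax).
  exact: near_eq_cvg.
move=> [df Df]; have nfg x : A x -> \near x, f x = g x.
  by move=> Ax; near=> y; apply: fg; near: y; exact: open_near.
split=> [x Ax|v]; first exact: near_eq_differentiable (nfg x Ax) (df x Ax).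
by apply: IH (Df v) => x Ax; exact: near_eq_derive (nfg x Ax).
Unshelve. all: by end_near. Qed.

Lemma Ck_onW n A f : Ck_on n.+1 A f -> Ck_on n A f.
Proof.
elim: n f => [f [df _] x Ax|n IH f [df Df]].
  by apply: differentiable_continuous; exact: df.
by split=> // v; apply: IH; exact: Df.
Qed.

Lemma Ck_onS n A B f : B `<=` A -> Ck_on n A f -> Ck_on n B f.
Proof.
move=> BA; elim: n f => [f cf x /BA|n IH f [df Df]]; first exact: cf.
by split=> [x /BA/df//|v]; apply: IH; exact: Df.
Qed.

Lemma smooth_on_ext A f g : open A -> (forall x, A x -> f x = g x) ->
  smooth_on A f -> smooth_on A g.
Proof. by move=> oA fg sf n; exact: Ck_on_ext oA fg (sf n). Qed.

Lemma smooth_onS A B f : B `<=` A -> smooth_on A f -> smooth_on B f.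
Proof. by move=> BA sf n; exact: Ck_onS BA (sf n). Qed.

Lemma smooth_on_diff A f x : smooth_on A f -> A x -> differentiable f x.
Proof. by move=> /(_ 1) [df _]; exact: df. Qed.

Lemma smooth_on_derivable A f x v : smooth_on A f -> A x -> derivable f x v.
Proof. by move=> sf Ax; apply/diff_derivable/(smooth_on_diff sf Ax). Qed.

Lemma smooth_on_cont A f x : smooth_on A f -> A x -> {for x, continuous f}.
Proof. by move=> /(_ 0) cf Ax; exact: cf. Qed.

Lemma smooth_on_derive A f v : smooth_on A f -> smooth_on A ('D_v f).
Proof. by move=> sf n; have [_] := sf n.+1; exact. Qed.

Lemma derive_ext A f g x v : open A -> (forall x, A x -> f x = g x) -> A x ->
  'D_v f x = 'D_v g x.
Proof.
move=> oA fg Ax; apply: near_eq_derive.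
by near=> y; apply: fg; near: y; exact: open_near.
Unshelve. all: by end_near. Qed.

Lemma Ck_on_cst n A (c : W) : Ck_on n A (cst c : V -> W).
Proof.
elim: n c => [c x _|n IH c]; first exact: cvg_cst.
split=> [x _|v]; first exact: differentiable_cst.
by rewrite (_ : 'D_v (cst c) = cst 0) //; apply/funext => x; rewrite derive_cst.
Qed.

Lemma Ck_onD n A f g : open A -> Ck_on n A f -> Ck_on n A g -> Ck_on n A (f + g).
Proof.
move=> oA; elim: n f g => [f g cf cg x Ax|n IH f g [df Df] [dg Dg]].
  exact: cvgD (cf x Ax) (cg x Ax).
split=> [x Ax|v]; first exact: differentiableD (df x Ax) (dg x Ax).
apply: (Ck_on_ext oA) (IH _ _ (Df v) (Dg v)) => x Ax.
by rewrite deriveD //; apply: diff_derivable; [exact: df|exact: dg].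
Qed.

Lemma smooth_on_cst A (c : W) : smooth_on A (fun _ : V => c).
Proof. by move=> n; exact: Ck_on_cst. Qed.

Lemma smooth_onD A f g : open A -> smooth_on A f -> smooth_on A g ->
  smooth_on A (fun x => f x + g x).
Proof. by move=> oA sf sg n; exact: Ck_onD. Qed.

Lemma smooth_on_sum (I : Type) (r : seq I) A (f : I -> V -> W) : open A ->
  (forall i, smooth_on A (f i)) -> smooth_on A (fun x => \sum_(i <- r) f i x).
Proof.
move=> oA sf; elim: r => [|i r IH].
  by under eq_fun do rewrite big_nil; exact: smooth_on_cst.
by under eq_fun do rewrite big_cons; exact: smooth_onD.
Qed.

End Locality.

Section Scalar.
Context {R : realType} {V : normedModType R}.
Implicit Types (f g : V -> R) (A : set V).

Lemma Ck_onM n A f g : open A -> Ck_on n A f -> Ck_on n A g -> Ck_on n A (f * g).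
Proof.
move=> oA; elim: n f g => [f g cf cg x Ax|n IH f g [df Df] [dg Dg]].
  exact: cvgM (cf x Ax) (cg x Ax).
split=> [x Ax|v]; first exact: differentiableM (df x Ax) (dg x Ax).
have Cf : Ck_on n A f by apply: Ck_onW; split.
have Cg : Ck_on n A g by apply: Ck_onW; split.
apply: (Ck_on_ext oA) (Ck_onD oA (IH _ _ Cf (Dg v)) (IH _ _ Cg (Df v))) => x Ax.
by rewrite deriveM //; apply: diff_derivable; [exact: df|exact: dg].
Qed.

Lemma Ck_onN n A f : open A -> Ck_on n A f -> Ck_on n A (- f).
Proof.
move=> oA Cf; have C1 : Ck_on n A (cst (-1) : V -> R) by exact: Ck_on_cst.
apply: (Ck_on_ext oA) (Ck_onM oA C1 Cf) => x _.
by rewrite !fctE mulN1r.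
Qed.

Lemma Ck_onV n A f : open A -> (forall x, A x -> f x != 0) -> Ck_on n A f ->
  Ck_on n A (fun x => (f x)^-1).
Proof.
move=> oA f0; elim: n => [cf x Ax|n IH Cf].
  by apply: cvgV (f0 x Ax) (cf x Ax).
have CV := IH (Ck_onW Cf); case: Cf => df Df.
split=> [x Ax|v].
  exact: differentiableV (df x Ax) (f0 x Ax).
apply: (Ck_on_ext oA) (Ck_onN oA (Ck_onM oA (Ck_onM oA CV CV) (Df v))) => x Ax.
rewrite deriveV ?f0 //; last exact/diff_derivable/df.
by rewrite /GRing.scale /= !fctE; field; rewrite f0.
Qed.

Lemma smooth_onM A f g : open A -> smooth_on A f -> smooth_on A g ->
  smooth_on A (fun x => f x * g x).
Proof. by move=> oA sf sg n; exact: Ck_onM. Qed.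

Lemma smooth_onV A f : open A -> (forall x, A x -> f x != 0) -> smooth_on A f ->
  smooth_on A (fun x => (f x)^-1).
Proof. by move=> oA f0 sf n; exact: Ck_onV. Qed.

Lemma smooth_on_prod (I : Type) (r : seq I) A (f : I -> V -> R) : open A ->
  (forall i, smooth_on A (f i)) -> smooth_on A (fun x => \prod_(i <- r) f i x).
Proof.
move=> oA sf; elim: r => [|i r IH].
  by under eq_fun do rewrite big_nil; exact: smooth_on_cst.
by under eq_fun do rewrite big_cons; exact: smooth_onM.
Qed.

Lemma derive_seg_MVT f x v (h : R) : 0 < h ->
  (forall t, 0 <= t <= h -> differentiable f (x + t *: v)) ->
  exists2 c, 0 < c < h & f (x + h *: v) - f x = h * 'D_v f (x + c *: v).
Proof.
move=> h0 df.
pose g (t : R) := f (x + t *: v).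
have dg (t : R) : 0 <= t <= h -> is_derive t 1 g ('D_v f (x + t *: v)).
  move=> th; have dt := df _ th.
  have dl : is_derive t (1:R) (fun s : R => x + s *: v) v.
    split.
      apply: derivableD; first exact: derivable_cst.
      exact/diff_derivable/differentiableZl.
    rewrite deriveD ?derive_cst ?add0r; last 2 first.
    - exact: derivable_cst.
    - exact/diff_derivable/differentiableZl.
    rewrite deriveE; last exact: differentiableZl.
    by rewrite diffZl // diff_val scale1r.
  have dlt : differentiable (fun s : R => x + s *: v) t.
    by apply: differentiableD => //; exact: differentiableZl.
  have dgt : differentiable g t by exact: differentiable_comp.
  split; first exact/diff_derivable.
  rewrite deriveE // /g (_ : (fun _ => _) = f \o (fun s : R => x + s *: v)) //.
  have e : 'd (fun s : R => x + s *: v) t 1 = v by rewrite -deriveE //; case: dl.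
  by rewrite diff_comp //= e deriveE.
have [t /[!in_itv]/= /andP[t0 th]||c /[!in_itv]/= /andP[c0 ch] e] :=
  @MVT R g (fun t => 'D_v f (x + t *: v)) 0 h h0.
- by apply: dg; rewrite !ltW.
- apply: derivable_within_continuous => t; rewrite in_itv /= => th.
  by have [] := dg _ th.
exists c; first by rewrite c0 ch.
by move: e; rewrite /g scale0r addr0 subr0 mulrC.
Qed.

End Scalar.

Section FiniteSums.
Context {R : realType} {V W : normedModType R}.

Lemma differentiable_fsum (I : Type) (s : seq I) (f : I -> V -> W) x :
  (forall i, differentiable (f i) x) -> differentiable (fun y => \sum_(i <- s) f i y) x.
Proof.
move=> df; elim: s => [|i s IH].
  by under eq_fun do rewrite big_nil; exact: differentiable_cst.
by under eq_fun do rewrite big_cons; exact: differentiableD.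
Qed.

Lemma derive_fsum (I : Type) (s : seq I) (f : I -> V -> W) x v :
  (forall i, differentiable (f i) x) ->
  'D_v (fun y => \sum_(i <- s) f i y) x = \sum_(i <- s) 'D_v (f i) x.
Proof.
move=> df; elim: s => [|i s IH].
  by under eq_fun do rewrite big_nil; rewrite big_nil derive_cst.
under eq_fun do rewrite big_cons; rewrite big_cons deriveD ?IH //.
  exact/diff_derivable/df.
exact/diff_derivable/differentiable_fsum.
Qed.

Lemma derive_scalel (f : V -> R) (w : W) x v : differentiable f x ->
  'D_v (fun y => f y *: w) x = 'D_v f x *: w.
Proof. by move=> df; rewrite deriveE ?diffZl ?deriveE //; exact: differentiableZl. Qed.

Lemma derive_along_cst (f : V -> W) x v :
  (forall h : R, f (h *: v + x) = f x) -> 'D_v f x = 0.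
Proof.
move=> fc; rewrite /derive; apply: lim_near_cst => //; near=> h.
by rewrite /= fc subrr scaler0.
Unshelve. all: by end_near. Qed.

End FiniteSums.

(** * Symmetry of second derivatives *)

Section Schwarz.
Context {R : realType} {V : normedModType R}.
Implicit Types (f g : V -> R) (A : set V).

Lemma derive_translate (W : normedModType R) (f : V -> W) (a x v : V) :
  'D_v (fun y => f (y + a)) x = 'D_v f (x + a).
Proof. by rewrite /derive; under eq_fun do rewrite /= -addrA. Qed.

Lemma differentiable_translate (W : normedModType R) (f : V -> W) (a x : V) :
  differentiable f (x + a) -> differentiable (fun y => f (y + a)) x.
Proof.
move=> df; rewrite (_ : (fun _ => _) = f \o (fun y => y + a)) //.
by apply: differentiable_comp => //; apply: differentiableD.
Qed.

(** The mean value theorem is used twice: along [v] for the difference of [f]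
    in the direction [w], then along [w] for the derivative of [f]. *)
Lemma second_difference_MVT f x v w (h : R) : 0 < h ->
  (forall s t, 0 <= s <= h -> 0 <= t <= h ->
    differentiable f (x + s *: v + t *: w) /\
    differentiable ('D_v f) (x + s *: v + t *: w)) ->
  exists c d, [/\ 0 < c < h, 0 < d < h &
    f (x + h *: v + h *: w) - f (x + h *: v) - (f (x + h *: w) - f x) =
    h * (h * 'D_w ('D_v f) (x + c *: v + d *: w))].
Proof.
move=> h0 H.
have hh : 0 <= h <= h by rewrite lexx ltW.
have h00 : 0 <= (0 : R) <= h by rewrite lexx ltW.
pose u y := f (y + h *: w) - f y.
have dfs s : 0 <= s <= h -> differentiable (fun y => f (y + h *: w)) (x + s *: v).
  by move=> sh; apply: differentiable_translate; have [] := H s h sh hh.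
have dfs' s : 0 <= s <= h -> differentiable f (x + s *: v).
  by move=> sh; have [] := H s 0 sh h00; rewrite scale0r addr0.
have du s : 0 <= s <= h -> differentiable u (x + s *: v).
  by move=> sh; apply: differentiableB; [exact: dfs|exact: dfs'].
have [c ch eu] := derive_seg_MVT h0 du.
have ch' : 0 <= c <= h by case/andP: ch => ? ?; rewrite !ltW.
have Du : 'D_v u (x + c *: v) =
          'D_v f (x + c *: v + h *: w) - 'D_v f (x + c *: v).
  rewrite /u deriveB ?derive_translate //.
  - by apply: diff_derivable; exact: dfs.
  - by apply: diff_derivable; exact: dfs'.
have [d dh ed] := @derive_seg_MVT R V ('D_v f) (x + c *: v) w h h0
  (fun t th => (H c t ch' th).2).
exists c, d; split=> //.
by rewrite -ed -Du -eu /u addrAC.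
Qed.

Lemma ler_dist_half (a b p e : R) : `|a - p| < e / 2 -> `|b - p| < e / 2 ->
  `|a - b| <= e.
Proof.
move=> l1 l2; apply: le_trans (ler_distD p _ _) _; rewrite [X in _ + X]distrC.
by rewrite ltW // (splitr e) ltrD.
Qed.

(** Both mixed derivatives are limits of the same second difference quotient. *)
Lemma derive_comm f A x v w : open A -> smooth_on A f -> A x ->
  'D_v ('D_w f) x = 'D_w ('D_v f) x.
Proof.
move=> oA sf Ax; apply/eqP; rewrite -subr_eq0 -normr_le0.
apply/ler_addgt0Pr => e e0; rewrite add0r.
have e20 : 0 < e / 2 by rewrite divr_gt0.
have c1 := smooth_on_cont (smooth_on_derive v (smooth_on_derive w sf)) Ax.
have c2 := smooth_on_cont (smooth_on_derive w (smooth_on_derive v sf)) Ax.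
have n1 : \forall y \near x, `|'D_v ('D_w f) x - 'D_v ('D_w f) y| < e / 2.
  by move/cvgrPdist_lt : c1; apply.
have n2 : \forall y \near x, `|'D_w ('D_v f) x - 'D_w ('D_v f) y| < e / 2.
  by move/cvgrPdist_lt : c2; apply.
have : \forall y \near x, [/\ A y, `|'D_v ('D_w f) x - 'D_v ('D_w f) y| < e / 2 &
   `|'D_w ('D_v f) x - 'D_w ('D_v f) y| < e / 2].
  by apply: filterS3 (open_near oA Ax) n1 n2 => y.
move=> /nbhs_normP [r /= r0 Hr].
pose h := r / (`|v| + `|w| + 1).
have k0 : 0 < `|v| + `|w| + 1 by rewrite ltr_wpDl // addr_ge0.
have h0 : 0 < h by rewrite divr_gt0.
have inball s t : 0 <= s <= h -> 0 <= t <= h -> `|x - (x + (s *: v + t *: w))| < r.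
  move=> /andP[s0 sh] /andP[t0 th]; rewrite opprD addrA subrr add0r normrN.
  apply: le_lt_trans (ler_normD _ _) _; rewrite !normrZ !ger0_norm //.
  apply: (@le_lt_trans _ _ (h * (`|v| + `|w|))).
    by rewrite mulrDr lerD // ler_wpM2r.
  by rewrite /h mulrAC ltr_pdivrMr // ltr_pM2l // ltrDl.
have Hvw s t sh th := Hr _ (inball s t sh th).
have [s t sh th|c [d [ch dh E1]]] := @second_difference_MVT f x v w h h0.
  rewrite -addrA; have [Ay _ _] := Hvw s t sh th.
  split; first exact: smooth_on_diff sf Ay.
  exact: smooth_on_diff (smooth_on_derive v sf) Ay.
have [s t sh th|c' [d' [c'h d'h E2]]] := @second_difference_MVT f x w v h h0.
  rewrite -addrA (addrC (s *: w)); have [Ay _ _] := Hvw t s th sh.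
  split; first exact: smooth_on_diff sf Ay.
  exact: smooth_on_diff (smooth_on_derive w sf) Ay.
have W c1' : 0 < c1' < h -> 0 <= c1' <= h by case/andP=> ? ?; rewrite !ltW.
have E : h * (h * 'D_w ('D_v f) (x + c *: v + d *: w)) =
       h * (h * 'D_v ('D_w f) (x + c' *: w + d' *: v)).
  apply: etrans (esym E1) _; apply: etrans E2; rewrite (addrAC x (h *: w)).
  by move: (f _) (f _) (f _) (f _) => p1 p2 p3 p4; ring.
move: E => /(mulfI (lt0r_neq0 h0))/(mulfI (lt0r_neq0 h0)) E.
have [_ _ l2] := Hvw c d (W _ ch) (W _ dh).
have [_ l1 _] := Hvw d' c' (W _ d'h) (W _ c'h).
move: E; rewrite -!addrA [c' *: w + _]addrC => E; move: l1 l2; rewrite E.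
set p := 'D_v ('D_w f) (x + _); move=> l1 l2.
exact: ler_dist_half l1 l2.
Qed.

End Schwarz.

(** * Matrix valued functions and composition *)

Section Matrix.
Context {R : realType} {V : normedModType R}.
Implicit Types (A : set V).

Lemma differentiable_mxP m n (f : V -> 'M[R]_(m, n)) x :
  differentiable f x <-> forall i j, differentiable (fun y => f y i j) x.
Proof.
split=> [df i j|df].
  rewrite (_ : (fun _ => _) = (fun N : 'M[R]_(m, n) => N i j) \o f) //.
  by apply: differentiable_comp => //; exact: differentiable_coord.
rewrite (_ : f = \sum_i \sum_j (fun y => f y i j *: delta_mx i j)).
  by do 2 (apply: differentiable_sum => ?); exact: differentiableZl.
apply/funext => y; rewrite fct_sumE [LHS]matrix_sum_delta.
by apply: eq_bigr => i _; rewrite fct_sumE.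
Qed.

Lemma derive_mxE m n (f : V -> 'M[R]_(m, n)) x v i j : differentiable f x ->
  ('D_v f x) i j = 'D_v (fun y => f y i j) x.
Proof. by move=> df; rewrite derive_mx ?mxE //; exact: diff_derivable. Qed.

Lemma Ck_on_mxP k m n A (f : V -> 'M[R]_(m, n)) : open A ->
  Ck_on k A f <-> forall i j, Ck_on k A (fun y => f y i j).
Proof.
move=> oA; elim: k f => [|k IH] f /=.
  split=> [cf i j x Ax|cf x Ax].
    suff : (f y i j @[y --> x]) --> f x i j by [].
    apply: (@cvg_comp _ _ _ f (fun N : 'M[R]_(m, n) => N i j)) (cf x Ax) _.
    exact: coord_continuous.
  suff : f y @[y --> x] --> f x by [].
  apply/cvgrPdist_lt => e e0; near=> y.
  rewrite [ltLHS]/Num.Def.normr/= mx_normrE; apply/bigmax_ltP; split=> // -[i j] _.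
  rewrite !mxE /=; move: i j.
  near: y; apply: filter_forall => i; apply: filter_forall => j.
  by have /cvgrPdist_lt := cf i j x Ax; apply.
split=> [[df Df] i j|Cf].
  split=> [x Ax|v]; first by have /differentiable_mxP := df x Ax; apply.
  apply: (Ck_on_ext oA) ((IH _).1 (Df v) i j) => x Ax.
  by rewrite derive_mxE //; exact: df.
have df x : A x -> differentiable f x.
  by move=> Ax; apply/differentiable_mxP => i j; have [dfij _] := Cf i j; exact: dfij.
split=> // v; apply/IH => i j; have [_ /(_ v)] := Cf i j.
by apply: Ck_on_ext => // x Ax; rewrite derive_mxE //; exact: df.
Unshelve. all: by end_near. Qed.

Lemma smooth_on_mxP m n A (f : V -> 'M[R]_(m, n)) : open A ->
  smooth_on A f <-> forall i j, smooth_on A (fun y => f y i j).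
Proof.
move=> oA; split=> [sf i j k|sf k]; first by apply/(Ck_on_mxP _ _ oA).1; exact: sf.
by apply/Ck_on_mxP => // i j; exact: sf.
Qed.

Lemma smooth_on_mulmx m n p A (f : V -> 'M[R]_(m, n)) (g : V -> 'M[R]_(n, p)) :
  open A -> smooth_on A f -> smooth_on A g -> smooth_on A (fun x => f x *m g x).
Proof.
move=> oA /smooth_on_mxP-/(_ oA) sf /smooth_on_mxP-/(_ oA) sg.
apply/smooth_on_mxP => // i j; under eq_fun do rewrite mxE.
by apply: smooth_on_sum => // l; exact: smooth_onM.
Qed.

Lemma derive_mulmx m n p (f : V -> 'M[R]_(m, n)) (g : V -> 'M[R]_(n, p)) x v :
  differentiable f x -> differentiable g x ->
  'D_v (fun y => f y *m g y) x = 'D_v f x *m g x + f x *m 'D_v g x.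
Proof.
move=> df dg; have [df' dg'] := ((differentiable_mxP _ _).1 df, (differentiable_mxP _ _).1 dg).
have dM i j l : derivable (fun y => f y i l * g y l j) x v.
  by apply: diff_derivable; apply: differentiableM.
apply/matrixP => i j; rewrite derive_mxE; last first.
  apply/differentiable_mxP => i' j'; under eq_fun do rewrite mxE.
  rewrite (_ : (fun _ => _) = \sum_l (fun y => f y i' l * g y l j')).
    by apply: differentiable_sum => l; apply: differentiableM.
  by apply/funext => y; rewrite fct_sumE.
rewrite (_ : (fun _ => _) = \sum_l (fun y => f y i l * g y l j)); last first.
  by apply/funext => y; rewrite fct_sumE mxE.
rewrite derive_sum // !mxE -big_split /=; apply: eq_bigr => l _.
rewrite deriveM; [|exact: diff_derivable|exact: diff_derivable].
by rewrite !derive_mxE // addrC; congr (_ + _); exact: mulrC.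
Qed.

End Matrix.

Section LinearMaps.
Context {R : realType}.

(** No continuity has to be assumed: by finite dimension a linear map is a
    combination of coordinate functions. *)
Lemma differentiable_linear_mx m n m' n' (L : {linear 'M[R]_(m, n) -> 'M[R]_(m', n')}) x :
  differentiable L x.
Proof.
apply/differentiable_mxP => i j.
rewrite (_ : (fun _ => _) =
  \sum_a \sum_b (fun y : 'M[R]_(m, n) => y a b *: (L (delta_mx a b) i j))).
  do 2 (apply: differentiable_sum => ?); apply: differentiableZl.
  exact: differentiable_coord.
apply/funext => y; rewrite [in LHS](matrix_sum_delta y) linear_sum summxE fct_sumE.
apply: eq_bigr => a _; rewrite linear_sum summxE fct_sumE.
by apply: eq_bigr => b _; rewrite linearZ mxE.
Qed.

Lemma derive_linear_mx m n m' n' (L : {linear 'M[R]_(m, n) -> 'M[R]_(m', n')}) x v :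
  'D_v L x = L v.
Proof.
rewrite /derive; apply: lim_near_cst => //; near=> h.
rewrite -linearB addrK linearZ scalerA mulVf ?scale1r //.
by near: h; exact: nbhs_dnbhs_neq.
Unshelve. all: by end_near. Qed.

Lemma smooth_on_linear_mx m n m' n' (L : {linear 'M[R]_(m, n) -> 'M[R]_(m', n')})
  (A : set 'M[R]_(m, n)) : smooth_on A L.
Proof.
case=> [x _|k]; first exact/differentiable_continuous/differentiable_linear_mx.
split=> [x _|v]; first exact: differentiable_linear_mx.
rewrite (_ : 'D_v L = cst (L v)); first exact: Ck_on_cst.
by apply/funext => x; rewrite derive_linear_mx.
Qed.

Lemma smooth_on_coord m n (A : set 'M[R]_(m, n)) i j :
  smooth_on A (fun y : 'M[R]_(m, n) => y i j).
Proof.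
case=> [x _|k]; first exact/differentiable_continuous/differentiable_coord.
split=> [x _|v]; first exact: differentiable_coord.
rewrite (_ : 'D_v _ = cst (v i j)); first exact: Ck_on_cst.
apply/funext => x; rewrite -(derive_mxE v i j (differentiable_linear_mx idfun x)).
by rewrite derive_linear_mx.
Qed.

End LinearMaps.

Section Composition.
Context {R : realType} {V : normedModType R} {n : nat}.
Implicit Types (A : set V) (B : set 'rV[R]_n) (g : V -> 'rV[R]_n).

Lemma derive_comp (W : normedModType R) (f : 'rV[R]_n -> W) g x v :
  differentiable f (g x) -> differentiable g x ->
  'D_v (fun y => f (g y)) x = 'D_('D_v g x) f (g x).
Proof.
move=> df dg; rewrite (_ : (fun _ => _) = f \o g) // deriveE.
  by rewrite diff_comp //= -!deriveE.
exact: differentiable_comp.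
Qed.

Lemma derive_dirE (W : normedModType R) (f : 'rV[R]_n -> W) z v :
  differentiable f z ->
  'D_v f z = \sum_j v 0 j *: 'D_(delta_mx 0 j) f z.
Proof.
move=> df; rewrite deriveE // {1}(row_sum_delta v) linear_sum.
by apply: eq_bigr => j _; rewrite linearZ deriveE.
Qed.

(** The derivative of a composite is a sum of products of lower order data, so
    the class of differentiability goes up by induction. *)
Lemma Ck_on_comp k A B (f : 'rV[R]_n -> R) g : open A -> open B ->
  (forall x, A x -> B (g x)) -> Ck_on k B f -> Ck_on k A g ->
  Ck_on k A (fun x => f (g x)).
Proof.
move=> oA oB AB; elim: k f => [|k IH] f Cf Cg.
  by move=> x Ax; apply: continuous_comp (Cg x Ax) (Cf _ (AB _ Ax)).
have Cgk := Ck_onW Cg; case: Cf Cg => df Df [dg Dg].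
split=> [x Ax|v].
  rewrite (_ : (fun _ => _) = f \o g) //.
  by apply: differentiable_comp; [exact: dg|exact/df/AB].
suff S : Ck_on k A (fun x => \sum_j ('D_v g x) 0 j * 'D_(delta_mx 0 j) f (g x)).
  apply: (Ck_on_ext oA) S => x Ax.
  by rewrite derive_comp ?derive_dirE //; [exact/df/AB|exact/df/AB|exact: dg].
elim: (index_enum _) => [|j r IHr].
  by under eq_fun do rewrite big_nil; exact: Ck_on_cst.
under eq_fun do rewrite big_cons; apply: Ck_onD => //.
apply: Ck_onM => //; last exact: IH (Df _) Cgk.
by have /(Ck_on_mxP _ _ oA) := Dg v; exact.
Qed.

Lemma smooth_on_comp_mx m p A B (f : 'rV[R]_n -> 'M[R]_(m, p)) g : open A -> open B ->
  (forall x, A x -> B (g x)) -> smooth_on B f -> smooth_on A g ->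
  smooth_on A (fun x => f (g x)).
Proof.
move=> oA oB AB sf sg; apply/smooth_on_mxP => // i j k.
apply: (@Ck_on_comp k A B (fun z => f z i j)) => //.
by have /smooth_on_mxP-/(_ oB) := sf; exact.
Qed.

End Composition.


(** * Basic functions in foliated coordinates *)

Section BasicSmooth.
Context {R : realType} {k q : nat}.
Implicit Types (A : set 'rV[R]_(k + q)).

(** The infinitesimal version of being smooth and constant along the plaques.
    Unlike local constancy, where the size of the neighborhood depends on the
    point, it is easily carried through differentiation. *)
Definition basic_smooth (W : normedModType R) A (f : 'rV[R]_(k + q) -> W) :=
  smooth_on A f /\ forall z, A z -> forall u : 'rV_k, 'D_(row_mx u 0) f z = 0.

Section Generic.
Context {W : normedModType R}.
Implicit Types f g : 'rV[R]_(k + q) -> W.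

Lemma basic_smooth_ext A f g : open A -> (forall z, A z -> f z = g z) ->
  basic_smooth A f -> basic_smooth A g.
Proof.
move=> oA fg [sf bf]; split; first exact: smooth_on_ext fg sf.
by move=> z Az u; rewrite -(derive_ext _ oA fg Az) bf.
Qed.

Lemma basic_smoothS A B f : B `<=` A -> basic_smooth A f -> basic_smooth B f.
Proof.
by move=> BA [sf bf]; split=> [|z /BA]; [exact: smooth_onS BA sf|exact: bf].
Qed.

Lemma basic_smooth_cst A (c : W) : basic_smooth A (fun=> c).
Proof.
by split=> [|z _ u]; [exact: smooth_on_cst|exact: derive_cst].
Qed.

Lemma basic_smoothD A f g : open A -> basic_smooth A f -> basic_smooth A g ->
  basic_smooth A (fun z => f z + g z).
Proof.
move=> oA [sf bf] [sg bg]; split; first exact: smooth_onD.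
move=> z Az u; rewrite deriveD ?bf ?bg ?addr0 //; exact: smooth_on_derivable Az.
Qed.

Lemma basic_smooth_sum (I : Type) (r : seq I) A (f : I -> 'rV[R]_(k + q) -> W) : open A ->
  (forall i, basic_smooth A (f i)) -> basic_smooth A (fun z => \sum_(i <- r) f i z).
Proof.
move=> oA sf; elim: r => [|i r IH].
  by under eq_fun do rewrite big_nil; exact: basic_smooth_cst.
by under eq_fun do rewrite big_cons; exact: basic_smoothD.
Qed.

(** The derivative in a leaf direction of a function constant on plaques is the
    limit of zero quotients. *)
Lemma basic_smooth_plaque A f : smooth_on A f ->
  (forall z, A z -> \forall z' \near z, rsubmx z' = rsubmx z -> f z' = f z) ->
  basic_smooth A f.
Proof.
move=> sf H; split=> // z Az u; rewrite /derive; apply: lim_near_cst => //.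
have cz : (fun h : R => h *: row_mx u 0 + z) @ 0^' --> z.
  rewrite -[X in _ --> X]add0r; apply: cvgD; last exact: cvg_cst.
  rewrite -[X in _ --> X](scale0r (row_mx u (0 : 'rV[R]_q))).
  by apply: cvgZr_tmp; exact: cvg_within.
near=> h; rewrite [X in X - _](_ : _ = f z) ?subrr ?scaler0 //.
have : rsubmx (h *: row_mx u 0 + z) = rsubmx z.
  by rewrite linearD linearZ /= row_mxKr scaler0 add0r.
by near: h; exact: cz (H z Az).
Unshelve. all: by end_near. Qed.

End Generic.

Section Scalar.
Implicit Types f g : 'rV[R]_(k + q) -> R.

Lemma basic_smoothM A f g : open A -> basic_smooth A f -> basic_smooth A g ->
  basic_smooth A (fun z => f z * g z).
Proof.
move=> oA [sf bf] [sg bg]; split; first exact: smooth_onM.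
move=> z Az u; rewrite deriveM ?bf ?bg ?scaler0 ?addr0 //;
  exact: smooth_on_derivable Az.
Qed.

Lemma basic_smoothV A f : open A -> (forall z, A z -> f z != 0) -> basic_smooth A f ->
  basic_smooth A (fun z => (f z)^-1).
Proof.
move=> oA f0 [sf bf]; split; first exact: smooth_onV.
move=> z Az u; rewrite deriveV ?f0 ?bf ?scaler0 //; exact: smooth_on_derivable Az.
Qed.

Lemma basic_smooth_prod (I : Type) (r : seq I) A (f : I -> 'rV[R]_(k + q) -> R) : open A ->
  (forall i, basic_smooth A (f i)) -> basic_smooth A (fun z => \prod_(i <- r) f i z).
Proof.
move=> oA sf; elim: r => [|i r IH].
  by under eq_fun do rewrite big_nil; exact: basic_smooth_cst.
by under eq_fun do rewrite big_cons; exact: basic_smoothM.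
Qed.

End Scalar.

Section Matrix.

Lemma basic_smooth_mxP m n A (f : 'rV[R]_(k + q) -> 'M[R]_(m, n)) : open A ->
  basic_smooth A f <-> forall i j, basic_smooth A (fun z => f z i j).
Proof.
move=> oA; split=> [[sf bf] i j|sf].
  split; first by have /smooth_on_mxP-/(_ oA) := sf; apply.
  by move=> z Az u; rewrite -derive_mxE ?bf ?mxE //; exact: smooth_on_diff Az.
have smf : smooth_on A f by apply/smooth_on_mxP => // i j; case: (sf i j).
split=> // z Az u; apply/matrixP => i j; have [_ bf] := sf i j.
by rewrite derive_mxE ?bf ?mxE //; exact: smooth_on_diff Az.
Qed.

Lemma basic_smooth_mulmx m n p A (f : 'rV[R]_(k + q) -> 'M[R]_(m, n))
    (g : 'rV[R]_(k + q) -> 'M[R]_(n, p)) : open A ->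
  basic_smooth A f -> basic_smooth A g -> basic_smooth A (fun z => f z *m g z).
Proof.
move=> oA [sf bf] [sg bg]; split; first exact: smooth_on_mulmx.
move=> z Az u; rewrite derive_mulmx ?bf ?bg ?mul0mx ?mulmx0 ?addr0 //;
  exact: smooth_on_diff Az.
Qed.

Lemma linear_mxE m n m' n' (L : {linear 'M[R]_(m, n) -> 'M[R]_(m', n')}) N i j :
  L N i j = \sum_a \sum_b N a b * L (delta_mx a b) i j.
Proof.
rewrite {1}(matrix_sum_delta N) linear_sum summxE; apply: eq_bigr => a _.
by rewrite linear_sum summxE; apply: eq_bigr => b _; rewrite linearZ mxE.
Qed.

Lemma basic_smooth_linear m n m' n' (L : {linear 'M[R]_(m, n) -> 'M[R]_(m', n')})
    A (f : 'rV[R]_(k + q) -> 'M[R]_(m, n)) : open A ->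
  basic_smooth A f -> basic_smooth A (fun z => L (f z)).
Proof.
move=> oA /basic_smooth_mxP-/(_ oA) sf; apply/basic_smooth_mxP => // i j.
under eq_fun do rewrite linear_mxE.
do 2 (apply: basic_smooth_sum => // ?); apply: basic_smoothM => //.
exact: basic_smooth_cst.
Qed.

Lemma basic_smooth_det m A (f : 'rV[R]_(k + q) -> 'M[R]_m) : open A ->
  basic_smooth A f -> basic_smooth A (fun z => \det (f z)).
Proof.
move=> oA /basic_smooth_mxP-/(_ oA) sf; rewrite /determinant.
apply: basic_smooth_sum => // s; apply: basic_smoothM => //.
  exact: basic_smooth_cst.
by apply: basic_smooth_prod => // i; exact: sf.
Qed.

Lemma basic_smooth_invmx m A (f : 'rV[R]_(k + q) -> 'M[R]_m) : open A ->
  (forall z, A z -> f z \in unitmx) ->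
  basic_smooth A f -> basic_smooth A (fun z => invmx (f z)).
Proof.
move=> oA uf sf; have /basic_smooth_mxP-/(_ oA) sf' := sf.
suff S : basic_smooth A (fun z => (\det (f z))^-1 *: \adj (f z)).
  by apply: (basic_smooth_ext oA) S => z Az; rewrite /invmx uf.
apply/basic_smooth_mxP => // i j; under eq_fun do rewrite !mxE.
apply: basic_smoothM => //.
  apply: basic_smoothV => //; last exact: basic_smooth_det.
  by move=> z /uf; rewrite unitmxE unitfE.
apply: basic_smoothM => //; first exact: basic_smooth_cst.
apply: basic_smooth_det => //; apply/basic_smooth_mxP => // a b.
under eq_fun do rewrite !mxE; exact: sf'.
Qed.

(** Differentiating along any direction preserves basic functions: by the
    symmetry of second derivatives the leaf derivatives can be taken first. *)
Lemma basic_smooth_derive m n A (f : 'rV[R]_(k + q) -> 'M[R]_(m, n)) v : open A ->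
  basic_smooth A f -> basic_smooth A ('D_v f).
Proof.
move=> oA sf; have [smf _] := sf.
apply/basic_smooth_mxP => // i j.
have /basic_smooth_mxP-/(_ oA)-/(_ i j) [sfij bfij] := sf.
apply: (@basic_smooth_ext _ _ ('D_v (fun z => f z i j))) => //.
  by move=> z Az; rewrite derive_mxE //; exact: smooth_on_diff Az.
split=> [|z Az u]; first exact: smooth_on_derive.
rewrite (derive_comm _ _ oA) // (derive_ext _ oA (g := cst 0)) ?derive_cst //.
by move=> y Ay; exact: bfij.
Qed.

(** On a ball, two points with equal transverse coordinates are joined by a
    segment inside their common plaque. *)
Lemma basic_smooth_locally_constant m n A (f : 'rV[R]_(k + q) -> 'M[R]_(m, n)) z :
  open A -> basic_smooth A f -> A z ->
  \forall z' \near z, rsubmx z' = rsubmx z -> f z' = f z.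
Proof.
move=> oA sf Az.
have /nbhs_normP [r /= r0 Hr] : \near z, A z by exact: open_near.
apply/nbhs_normP; exists r => //= z' /= zz' e; apply/matrixP => i j.
have /basic_smooth_mxP-/(_ oA)-/(_ i j) [sfij bfij] := sf.
have eu : z' - z = row_mx (lsubmx (z' - z)) 0.
  by rewrite -[LHS]hsubmxK; congr row_mx; rewrite linearB /= e subrr.
have Ac c : 0 <= c <= 1 -> A (z + c *: (z' - z)).
  move=> /andP[c0 c1]; apply: Hr => /=.
  rewrite opprD addrA subrr sub0r normrN normrZ ger0_norm // distrC.
  by apply: le_lt_trans zz'; rewrite ler_piMl.
have dc c : 0 <= c <= 1 -> differentiable (fun y => f y i j) (z + c *: (z' - z)).
  by move=> /Ac; exact: smooth_on_diff.
have [c /andP[c0 c1] E] := derive_seg_MVT ltr01 dc.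
have c01 : 0 <= c <= 1 by rewrite !ltW.
have := bfij _ (Ac c c01) (lsubmx (z' - z)); rewrite -eu => D0.
move: E; rewrite scale1r (addrC z (z' - z)) subrK D0 mulr0.
by move=> /eqP; rewrite subr_eq0 => /eqP.
Qed.

End Matrix.
End BasicSmooth.

Section FoliatedMaps.
Context {R : realType} {k q k' q' : nat}.
Implicit Types (A : set 'rV[R]_(k + q)) (B : set 'rV[R]_(k' + q')).
Implicit Types (g : 'rV[R]_(k + q) -> 'rV[R]_(k' + q')).

(** The maps along which basic functions can be pulled back; the transition
    maps between foliated charts are of this kind. *)
Definition foliated_map A g :=
  smooth_on A g /\ forall z, A z -> forall u : 'rV_k, rsubmx ('D_(row_mx u 0) g z) = 0.

Lemma foliated_mapS A A' g : A' `<=` A -> foliated_map A g -> foliated_map A' g.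
Proof.
by move=> AA [sf bf]; split=> [|z /AA]; [exact: smooth_onS AA sf|exact: bf].
Qed.

Lemma foliated_mapP A g : open A -> foliated_map A g <->
  smooth_on A g /\ basic_smooth A (fun z => rsubmx (g z)).
Proof.
move=> oA; split=> [[sg bg]|[sg [sg' bg]]]; split=> //.
  have /smooth_on_mxP-/(_ oA) sg' := sg.
  split=> [|z Az u].
    by apply/smooth_on_mxP => // i j; under eq_fun do rewrite mxE; exact: sg'.
  rewrite -[RHS](bg z Az u); apply/matrixP => i j.
  have dg := smooth_on_diff sg Az.
  rewrite derive_mxE; last first.
    apply/differentiable_mxP => i' j'; under eq_fun do rewrite mxE.
    by have /differentiable_mxP := dg; exact.
  by rewrite mxE derive_mxE //; under eq_fun do rewrite mxE.
move=> z Az u; rewrite -[RHS](bg z Az u); apply/matrixP => i j.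
rewrite derive_mxE ?mxE ?derive_mxE; last 2 first.
- exact: smooth_on_diff Az.
- exact: smooth_on_diff Az.
by under [in RHS]eq_fun do rewrite mxE.
Qed.

Lemma basic_smooth_comp m n A B g (f : 'rV[R]_(k' + q') -> 'M[R]_(m, n)) :
  open A -> open B -> (forall z, A z -> B (g z)) ->
  basic_smooth B f -> foliated_map A g -> basic_smooth A (fun z => f (g z)).
Proof.
move=> oA oB AB [sf bf] [sg bg]; split; first exact: smooth_on_comp_mx sf sg.
move=> z Az u; rewrite derive_comp; last 2 first.
- exact: smooth_on_diff (AB _ Az).
- exact: smooth_on_diff Az.
move: (bg z Az u); set d := 'D_(row_mx u 0) g z => bd.
by rewrite -(hsubmxK d) bd bf //; exact: AB.
Qed.

End FoliatedMaps.


(* Otherwise unification unfolds derivatives down to limits along filters. *)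
Local Opaque derive.

(** * Transverse Jacobians *)

Section TransverseJacobian.
Context {R : realType}.

Section Def.
Context {k q k' q' : nat}.
Implicit Types (A : set 'rV[R]_(k + q)) (g : 'rV[R]_(k + q) -> 'rV[R]_(k' + q')).

(** The matrix of the map induced on directions transverse to the leaves. It
    acts on row vectors from the right. *)
Definition tjac g z : 'M[R]_(q, q') :=
  \matrix_(a, b) rsubmx ('D_(row_mx 0 (delta_mx 0 a)) g z) 0 b.

Lemma derive_basic (W : normedModType R) A (f : 'rV[R]_(k + q) -> W) z v :
  basic_smooth A f -> A z -> 'D_v f z = 'D_(row_mx 0 (rsubmx v)) f z.
Proof.
move=> [sf bf] Az; have df := smooth_on_diff sf Az.
have e : v = row_mx (lsubmx v) 0 + row_mx 0 (rsubmx v).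
  by rewrite add_row_mx addr0 add0r hsubmxK.
by rewrite deriveE // {1}e linearD -!deriveE // bf // add0r.
Qed.

Lemma derive_xE (W : normedModType R) (f : 'rV[R]_(k + q) -> W) z (v : 'rV_q) :
  differentiable f z ->
  'D_(row_mx 0 v) f z = \sum_a v 0 a *: 'D_(row_mx 0 (delta_mx 0 a)) f z.
Proof.
move=> df; rewrite deriveE //.
have e : row_mx 0 v = \sum_a v 0 a *: row_mx 0 (delta_mx 0 a) :> 'rV[R]_(k + q).
  have E w : row_mx 0 w = w *m row_mx 0 1%:M :> 'rV[R]_(k + q).
    by rewrite mul_mx_row mulmx0 mulmx1.
  rewrite E {1}(row_sum_delta v) mulmx_suml; apply: eq_bigr => a _.
  by rewrite -scalemxAl -E.
by rewrite e linear_sum; apply: eq_bigr => a _; rewrite linearZ deriveE.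
Qed.

Lemma tjacE A g z v : foliated_map A g -> A z ->
  rsubmx ('D_v g z) = rsubmx v *m tjac g z.
Proof.
move=> [sg bg] Az; have dg := smooth_on_diff sg Az.
have e : v = row_mx (lsubmx v) 0 + row_mx 0 (rsubmx v).
  by rewrite add_row_mx addr0 add0r hsubmxK.
have -> : rsubmx ('D_v g z) = rsubmx ('D_(row_mx 0 (rsubmx v)) g z).
  rewrite (deriveE _ dg) {1}e [X in rsubmx X]linearD -!(deriveE _ dg).
  have rD (x y : 'rV[R]_(k' + q')) : rsubmx (x + y) = rsubmx x + rsubmx y.
    exact: linearD.
  by rewrite rD [X in X + _](bg z Az (lsubmx v)) add0r.
rewrite derive_xE // linear_sum; apply/rowP => b; rewrite summxE mxE.
by apply: eq_bigr => a _; rewrite linearZ mxE [tjac _ _ _ _]mxE.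
Qed.

Lemma tjac_basic_smooth A g : open A -> foliated_map A g -> basic_smooth A (tjac g).
Proof.
move=> oA fg; have [sg br] := (foliated_mapP _ oA).1 fg.
apply/basic_smooth_mxP => // a b.
have /(basic_smooth_mxP _ oA)-/(_ 0 b) :=
  basic_smooth_derive (row_mx 0 (delta_mx 0 a)) oA br.
apply: basic_smooth_ext => // z Az.
have dg := smooth_on_diff sg Az; have dr := smooth_on_diff br.1 Az.
rewrite [RHS]mxE [RHS]mxE (derive_mxE _ _ _ dg) (derive_mxE _ _ _ dr).
by under eq_fun do rewrite mxE.
Qed.

Lemma tjac_ext A g g' z : open A -> A z -> (forall y, A y -> g y = g' y) ->
  tjac g z = tjac g' z.
Proof.
move=> oA Az gg'; apply/matrixP => a b; rewrite [LHS]mxE [RHS]mxE.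
by rewrite (derive_ext _ oA gg' Az).
Qed.

End Def.

(** Chain rule for a basic function: only the transverse part of the inner map
    matters. *)
Lemma derive_basic_comp {k q k' q' : nat} (W : normedModType R)
    (A : set 'rV[R]_(k + q)) (B : set 'rV[R]_(k' + q')) g
    (f : 'rV[R]_(k' + q') -> W) (z v : 'rV[R]_(k + q)) :
  (forall z, A z -> B (g z)) -> basic_smooth B f -> foliated_map A g -> A z ->
  'D_v (fun y => f (g y)) z = 'D_(row_mx 0 (rsubmx v *m tjac g z)) f (g z).
Proof.
move=> AB bf fg Az; rewrite derive_comp.
- by rewrite (derive_basic _ bf (AB _ Az)) (tjacE _ fg Az).
- exact: smooth_on_diff bf.1 (AB _ Az).
- exact: smooth_on_diff fg.1 Az.
Qed.

End TransverseJacobian.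

(** * Foliated atlases *)

Section FoliatedAtlas.
Context {R : realType} {M : topologicalType} {k q : nat} (F : fatlas R M k q).

(** The part of [foliation] that concerns the foliated charts alone; it also
    holds for the charts of total spaces, which come without a reference atlas. *)
Definition foliated_atlas :=
  smooth_atlas F /\ forall j, basic_on F (cdom (F j)) (@xcoord _ _ _ _ F j).

(** Meaningful only on the image of the overlap of the two domains. *)
Definition transition i j := read (F i) (F j).

Definition chart_img (i : aidx F) (U : set M) : set 'rV[R]_(k + q) := F i @` U.

Context (hF : foliated_atlas).

Lemma atlas_chart i : is_chart (F i). Proof. by case: hF => -[]. Qed.

Lemma cdom_open i : open (cdom (F i)). Proof. by case: (atlas_chart i). Qed.

Lemma atlas_cover p : exists i, cdom (F i) p. Proof. by case: hF => -[]. Qed.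

Lemma readF (W : zmodType) i (f : M -> W) p : cdom (F i) p -> read (F i) f (F i p) = f p.
Proof. by apply: readE; case: (atlas_chart i). Qed.

Lemma transitionE i j p : cdom (F i) p -> transition i j (F i p) = F j p.
Proof. exact: readF. Qed.

Lemma chart_img_open i U : open U -> U `<=` cdom (F i) -> open (chart_img i U).
Proof. by move=> oU Ui; have [_ _ _] := atlas_chart i; apply. Qed.

Lemma dom2_open i j : open (cdom (F i) `&` cdom (F j)).
Proof. by apply: openI; exact: cdom_open. Qed.

Lemma chart_img2_open i j : open (chart_img i (cdom (F i) `&` cdom (F j))).
Proof. by apply: chart_img_open; [exact: dom2_open|exact: subIsetl]. Qed.

Lemma near_chart i p (P : M -> Prop) : cdom (F i) p -> (\forall p' \near p, P p') ->
  \forall z \near F i p, exists p', [/\ cdom (F i) p', F i p' = z & P p'].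
Proof.
move=> ip nP; have : nbhs p P by [].
rewrite nbhsE => -[U [oU Up] UP].
have oV : open (chart_img i (U `&` cdom (F i))).
  by apply: chart_img_open; [apply: openI => //; exact: cdom_open|exact: subIsetr].
have Vp : chart_img i (U `&` cdom (F i)) (F i p) by exists p.
by apply: filterS (open_near oV Vp) => _ [p' [/UP ? ?] <-]; exists p'.
Qed.

Lemma near_chart_inv i p (Q : 'rV[R]_(k + q) -> Prop) : cdom (F i) p ->
  (\forall z \near F i p, Q z) -> \forall p' \near p, cdom (F i) p' /\ Q (F i p').
Proof.
move=> ip nQ; have [_ _ /(_ p ip) c _] := atlas_chart i.
near=> p'; split; near: p'; last exact: (c _ nQ).
by apply: open_near => //; exact: cdom_open.
Unshelve. all: by end_near. Qed.

(** The transverse coordinates of a chart are constant on the plaques of every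
    other chart, by definition of a foliation. *)
Lemma transition_foliated i j :
  foliated_map (chart_img i (cdom (F i) `&` cdom (F j))) (transition i j).
Proof.
have oA : open (chart_img i (cdom (F i) `&` cdom (F j))) by exact: chart_img2_open.
have sm : smooth_on (chart_img i (cdom (F i) `&` cdom (F j))) (transition i j).
  by have [[_ _ /(_ i j)]] := hF; rewrite /smooth_transition /smooth_in_chart setIC.
apply/foliated_mapP => //; split => //; apply: basic_smooth_plaque.
  have /(smooth_on_mxP _ oA) sm' := sm.
  by apply/smooth_on_mxP => // a b; under eq_fun do rewrite mxE; exact: sm'.
move=> _ [p [ip jp] <-]; have [_ /(_ j i p jp ip) H] := hF.
have := near_chart ip H; apply: filterS => z [p' [ip' <- H']].
by rewrite !transitionE //; exact: H'.
Qed.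

(** Smoothness and constancy along the leaves refer to all charts, but can be
    checked in a single one because transition maps are foliated. *)
Lemma fsmooth_basic_of_read m n i U (h : M -> 'M[R]_(m, n)) H :
  open U -> U `<=` cdom (F i) -> basic_smooth (chart_img i U) H ->
  (forall p, U p -> h p = H (F i p)) -> fsmooth_on F U h /\ basic_on F U h.
Proof.
move=> oU Ui bH hH.
have key j : basic_smooth (chart_img j (U `&` cdom (F j))) (read (F j) h).
  have oA : open (chart_img j (U `&` cdom (F j))).
    by apply: chart_img_open; [apply: openI => //; exact: cdom_open|exact: subIsetr].
  have sub : chart_img j (U `&` cdom (F j)) `<=` chart_img j (cdom (F j) `&` cdom (F i)).
    by move=> _ [p [/[dup] Up /Ui ip] jp] <-; exists p.
  apply: (@basic_smooth_ext _ _ _ _ _ (fun z => H (transition j i z))) => //.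
    by move=> _ [p [Up jp] <-]; rewrite transitionE // readF // hH.
  apply: (@basic_smooth_comp _ _ _ _ _ _ _ _ (chart_img i U)) => //.
  - exact: chart_img_open.
  - by move=> _ [p [Up jp] <-]; rewrite transitionE //; exists p.
  - exact: foliated_mapS sub (transition_foliated j i).
split=> j; first by case: (key j).
move=> p Up jp.
have oA : open (chart_img j (U `&` cdom (F j))).
  by apply: chart_img_open; [apply: openI => //; exact: cdom_open|exact: subIsetr].
have Ap : chart_img j (U `&` cdom (F j)) (F j p) by exists p.
have := near_chart_inv jp (basic_smooth_locally_constant oA (key j) Ap).
by apply: filterS => p' [jp' +] _; rewrite !readF.
Qed.

Lemma read_of_fsmooth_basic m n i U (h : M -> 'M[R]_(m, n)) :
  open U -> U `<=` cdom (F i) -> fsmooth_on F U h -> basic_on F U h ->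
  basic_smooth (chart_img i U) (read (F i) h).
Proof.
move=> oU Ui /(_ i); rewrite /smooth_in_chart setIidl // => sh bh.
apply: basic_smooth_plaque => // _ [p Up <-]; have ip := Ui p Up.
have := near_chart ip (bh i p Up ip); apply: filterS => z [p' [ip' <- H]].
by rewrite !readF //; exact: H.
Qed.

Definition tjac_transition i j z := tjac (transition i j) z.

Lemma tjac_transition_basic i j :
  basic_smooth (chart_img i (cdom (F i) `&` cdom (F j))) (tjac_transition i j).
Proof. by apply: tjac_basic_smooth; [exact: chart_img2_open|exact: transition_foliated]. Qed.

(** Chain rule for the transition maps of three charts. *)
Lemma derive_transition_chain i j l p v :
  cdom (F i) p -> cdom (F j) p -> cdom (F l) p ->
  'D_('D_v (transition i j) (F i p)) (transition j l) (F j p) = 'D_v (transition i l) (F i p).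
Proof.
move=> ip jp lp; pose A := chart_img i (cdom (F i) `&` (cdom (F j) `&` cdom (F l))).
have oA : open A.
  by apply: chart_img_open; [apply: openI; [exact: cdom_open|exact: dom2_open]|exact: subIsetl].
have Ap : A (F i p) by exists p.
have e y : A y -> transition j l (transition i j y) = transition i l y.
  by move=> [p' [ip' [jp' lp']] <-]; rewrite !transitionE.
have dij : differentiable (transition i j) (F i p).
  by apply: smooth_on_diff (transition_foliated i j).1 _; exists p.
have djl : differentiable (transition j l) (transition i j (F i p)).
  by rewrite transitionE //; apply: smooth_on_diff (transition_foliated j l).1 _; exists p.
by rewrite -(derive_ext v oA e Ap) (derive_comp v djl dij) transitionE.
Qed.

Lemma derive_transition_id i p v : cdom (F i) p -> 'D_v (transition i i) (F i p) = v.
Proof.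
move=> ip; have e y : chart_img i (cdom (F i)) y -> transition i i y = y.
  by move=> [p' ip' <-]; rewrite transitionE.
have oA : open (chart_img i (cdom (F i))) by apply: chart_img_open => //; exact: cdom_open.
by rewrite (derive_ext v oA e) ?derive_id //; exists p.
Qed.

Lemma tjac_transition_derive i j p v : cdom (F i) p -> cdom (F j) p ->
  rsubmx ('D_v (transition i j) (F i p)) = rsubmx v *m tjac_transition i j (F i p).
Proof. by move=> ip jp; apply: tjacE (transition_foliated i j) _; exists p. Qed.

Lemma tjac_transition_cocycle i j l p : cdom (F i) p -> cdom (F j) p -> cdom (F l) p ->
  tjac_transition i j (F i p) *m tjac_transition j l (F j p) = tjac_transition i l (F i p).
Proof.
move=> ip jp lp; apply/row_matrixP => a.
rewrite !rowE mulmxA; set d := delta_mx 0 a.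
have E i' j' : cdom (F i') p -> cdom (F j') p ->
    d *m tjac_transition i' j' (F i' p) = rsubmx ('D_(row_mx 0 d) (transition i' j') (F i' p)).
  by move=> ip' jp'; rewrite (tjac_transition_derive _ ip' jp') row_mxKr.
by rewrite (E _ _ ip jp) (E _ _ ip lp) -(tjac_transition_derive _ jp lp)
  (derive_transition_chain _ ip jp lp).
Qed.

Lemma tjac_transition_id i p : cdom (F i) p -> tjac_transition i i (F i p) = 1%:M.
Proof.
move=> ip; apply/row_matrixP => a.
rewrite !rowE mulmx1; have e := row_mxKr (0 : 'rV[R]_k) (delta_mx 0 a : 'rV[R]_q).
by rewrite -{1}e -!tjac_transition_derive // derive_transition_id.
Qed.

Lemma tjac_transition_inv i j p : cdom (F i) p -> cdom (F j) p ->
  tjac_transition i j (F i p) *m tjac_transition j i (F j p) = 1%:M.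
Proof. by move=> ip jp; rewrite tjac_transition_cocycle // tjac_transition_id. Qed.

Lemma tjac_transition_unit i j p : cdom (F i) p -> cdom (F j) p ->
  tjac_transition i j (F i p) \in unitmx.
Proof. by move=> ip jp; exact: (mulmx1_unit (tjac_transition_inv ip jp)).1. Qed.

End FoliatedAtlas.

(** * The normal bundle and its foliated metrics *)

Section NormalBundle.
Context {R : realType} {M : topologicalType} {k q : nat} {F : fatlas R M k q}.
Context (hF : foliated_atlas F).

(** The axioms of a foliated vector bundle. The linear structure of the fibers
    is implicit: it is the one for which the trivializations are linear. *)
Definition foliated_bundle m (E : fbundle F m) :=
  (forall i p, cdom (F i) p ->
     (forall a b : fiber E p, triv i a = triv i b -> a = b) /\
     (forall y, exists a : fiber E p, triv i a = y)) /\
  forall i j, exists T,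
    basic_smooth (chart_img i (cdom (F i) `&` cdom (F j))) T /\
    forall p (a : fiber E p), cdom (F i) p -> cdom (F j) p ->
      triv j a = triv i a *m T (F i p).

Lemma diff_transitionE i j p v : cdom (F i) p -> cdom (F j) p ->
  'd (transition i j) (F i p) v = 'D_v (transition i j) (F i p).
Proof.
move=> ip jp; rewrite deriveE //.
by apply: smooth_on_diff (transition_foliated hF i j).1 _; exists p.
Qed.

Lemma tangent_spaceP p (t : tangent_space F p) i j : cdom (F i) p -> cdom (F j) p ->
  sval t j = 'D_(sval t i) (transition i j) (F i p).
Proof. by move=> ip jp; apply: etrans ((svalP t).1 i j ip jp) _; exact: diff_transitionE. Qed.

Definition tangent_family i p (v : 'rV[R]_(k + q)) (j : aidx F) : 'rV[R]_(k + q) :=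
  if pselect (cdom (F j) p) then 'D_v (transition i j) (F i p) else 0.

Lemma tangent_family_subproof i p v : cdom (F i) p ->
  (forall j l, cdom (F j) p -> cdom (F l) p ->
     tangent_family i p v l = 'd (read (F j) (F l)) (F j p) (tangent_family i p v j)) /\
  (forall j, ~ cdom (F j) p -> tangent_family i p v j = 0).
Proof.
move=> ip; rewrite /tangent_family; split=> [j l jp lp|j jp]; last by case: pselect.
case: pselect => // lp'; case: pselect => // jp'.
by rewrite -/(transition j l) diff_transitionE // derive_transition_chain.
Qed.

(** Components in one chart can be prescribed freely; the chain rule makes the
    components they determine in the other charts consistent. *)
Lemma exists_tangent i p v : cdom (F i) p -> exists t : tangent_space F p, sval t i = v.
Proof.
move=> ip; pose t : tangent_space F p :=
  exist _ (tangent_family i p v) (tangent_family_subproof v ip).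
exists t => /=.
by rewrite /tangent_family; case: pselect => // ip'; rewrite derive_transition_id.
Qed.

Lemma exists_tangent_lin p (c : R) (s t : tangent_space F p) :
  exists w : tangent_space F p, forall i, sval w i = c *: sval s i + sval t i.
Proof.
suff P : (forall i j, cdom (F i) p -> cdom (F j) p -> c *: sval s j + sval t j =
      'd (read (F i) (F j)) (F i p) (c *: sval s i + sval t i)) /\
    (forall i, ~ cdom (F i) p -> c *: sval s i + sval t i = 0).
  pose w : tangent_space F p := exist _ (fun i => c *: sval s i + sval t i) P.
  by exists w.
case: s t => s [s1 s2] [t [t1 t2]] /=; split=> [i j ip jp|i ip].
  by rewrite (s1 i j) // (t1 i j) // linearD linearZ.
by rewrite s2 // t2 // scaler0 addr0.
Qed.

Lemma tangent_tjac p (t : tangent_space F p) i j : cdom (F i) p -> cdom (F j) p ->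
  rsubmx (sval t j) = rsubmx (sval t i) *m tjac_transition i j (F i p).
Proof. by move=> ip jp; rewrite -tjac_transition_derive // -tangent_spaceP. Qed.

Lemma tau_coset_refl p (v : tangent_space F p) : tau_coset v v.
Proof.
have [z zE] := exists_tangent_lin (-1) v v.
have z0 i : sval z i = 0 by rewrite zE scaleN1r addNr.
by exists z => i; rewrite ?z0 ?addr0 ?linear0.
Qed.

(** Vectors of the same coset differ by a vector along the leaf, whose
    transverse components vanish; so any representative computes the
    trivialization. *)
Lemma normal_triv_coset i p (t : tangent_space F p) (C : normal_fiber F p) :
  sval C = tau_coset t -> cdom (F i) p -> normal_triv i C = rsubmx (sval t i).
Proof.
move=> Ct ip; rewrite /normal_triv; case: (cid _) => v /= Cv.
have : tau_coset v t by rewrite -Cv Ct; exact: tau_coset_refl.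
by move=> [s s0 ->]; rewrite linearD /= (s0 i ip) addr0.
Qed.

Lemma normal_triv_tjac p (C : normal_fiber F p) i j : cdom (F i) p -> cdom (F j) p ->
  normal_triv j C = normal_triv i C *m tjac_transition i j (F i p).
Proof.
move=> ip jp; have [t Ct] := svalP C.
by rewrite !(normal_triv_coset Ct) // (tangent_tjac t ip jp).
Qed.

Lemma normal_triv_surj i p y : cdom (F i) p ->
  exists C : normal_fiber F p, normal_triv i C = y.
Proof.
move=> ip; have [t ti] := exists_tangent (row_mx 0 y) ip.
pose C : normal_fiber F p := exist _ (tau_coset t) (ex_intro _ t erefl).
by exists C; rewrite (@normal_triv_coset i p t C) // ti row_mxKr.
Qed.

Lemma tau_coset_sub p (v w : tangent_space F p) i : cdom (F i) p ->
  rsubmx (sval v i) = rsubmx (sval w i) -> tau_coset v `<=` tau_coset w.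
Proof.
move=> ip e x [s s0 xs].
have [t tE] := exists_tangent_lin (-1) w v.
have [u uE] := exists_tangent_lin 1 t s.
exists u => [j jp|j].
  rewrite uE scale1r linearD /= (s0 j jp) addr0 (tangent_tjac t ip jp) tE linearD linearZ /= e.
  by rewrite scaleN1r addNr mul0mx.
by rewrite xs uE tE scale1r scaleN1r addrA addrA subrr add0r.
Qed.

Lemma eq_sval (T : Type) (P : T -> Prop) (a b : {x | P x}) : sval a = sval b -> a = b.
Proof.
by case: a b => [x hx] [y hy] /= e; subst y; congr exist; exact: Prop_irrelevance.
Qed.

Lemma normal_triv_inj i p (C D : normal_fiber F p) : cdom (F i) p ->
  normal_triv i C = normal_triv i D -> C = D.
Proof.
move=> ip; have [t Ct] := svalP C; have [s Ds] := svalP D.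
rewrite (normal_triv_coset Ct) // (normal_triv_coset Ds) // => e.
apply: eq_sval; rewrite Ct Ds eqEsubset.
by split; apply: (tau_coset_sub ip).
Qed.

Lemma normal_bundle_foliated : foliated_bundle (normal_bundle F).
Proof.
split=> [i p ip|i j].
  by split=> [a b|y]; [exact: normal_triv_inj|exact: normal_triv_surj].
exists (tjac_transition i j); split; first exact: tjac_transition_basic.
by move=> p a ip jp; exact: normal_triv_tjac.
Qed.

(** The matrices, in coordinates, of a foliated metric of the normal bundle. The
    last condition says that they define one form on each fiber. *)
Definition coord_metric (H : aidx F -> 'rV[R]_(k + q) -> 'M[R]_q) :=
  [/\ (forall i, basic_smooth (chart_img i (cdom (F i))) (H i)),
      (forall i p, cdom (F i) p -> (H i (F i p))^T = H i (F i p) /\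
         forall y : 'rV_q, y != 0 -> 0 < (y *m H i (F i p) *m y^T) 0 0) &
      (forall i j p, cdom (F i) p -> cdom (F j) p ->
         H i (F i p) =
         tjac_transition i j (F i p) *m H j (F j p) *m (tjac_transition i j (F i p))^T)].

Lemma form_eq n (A B : 'M[R]_n) :
  (forall y z : 'rV_n, (y *m A *m z^T) 0 0 = (y *m B *m z^T) 0 0) -> A = B.
Proof.
move=> H; apply/matrixP => a b; have := H (delta_mx 0 a) (delta_mx 0 b).
by rewrite -!rowE trmx_delta -!colE !mxE.
Qed.

(** Every row vector is the trivialization of a normal vector, which turns the
    equality of the forms given by two charts into one of matrices. *)
Lemma riemannianP : riemannian F <-> exists H, coord_metric H.
Proof.
split=> [[g hg]|[H [bH pH tH]]].
  pose G i := projT1 (cid (hg i)).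
  have hG i : [/\ fsmooth_on F (cdom (F i)) (G i), basic_on F (cdom (F i)) (G i) &
     forall p, cdom (F i) p ->
          [/\ (G i p)^T = G i p,
              (forall y : 'rV[R]_q, y != 0 -> 0 < (y *m G i p *m y^T) 0 0) &
              forall a b : fiber (normal_bundle F) p,
                g p a b = (triv i a *m G i p *m (triv i b)^T) 0 0]].
    by rewrite /G; case: (cid _).
  exists (fun i => read (F i) (G i)); split=> [i|i p ip|i j p ip jp].
  - have [sG bG _] := hG i.
    by apply: read_of_fsmooth_basic => //; exact: cdom_open.
  - by rewrite readF //; have [_ _ /(_ p ip) []] := hG i.
  - rewrite !readF //; apply: form_eq => y z.
    have [a <-] := normal_triv_surj y ip; have [b <-] := normal_triv_surj z ip.
    have [_ _ /(_ p ip) [_ _ /(_ a b) /= <-]] := hG i.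
    have [_ _ /(_ p jp) [_ _ /(_ a b) /= ->]] := hG j.
    by rewrite (normal_triv_tjac a ip jp) (normal_triv_tjac b ip jp) trmx_mul !mulmxA.
pose c p := projT1 (cid (atlas_cover hF p)).
have cp p : cdom (F (c p)) p by rewrite /c; case: (cid _).
exists (fun p a b => (normal_triv (c p) a *m H (c p) (F (c p) p) *m
                      (normal_triv (c p) b)^T) 0 0) => i.
exists (fun p => H i (F i p)).
have [sH bH'] : fsmooth_on F (cdom (F i)) (fun p => H i (F i p)) /\
    basic_on F (cdom (F i)) (fun p => H i (F i p)).
  exact: (fsmooth_basic_of_read hF (cdom_open hF _) (fun _ x => x) (bH i)).
split=> // p ip; have [sy po] := pH i p ip; split=> // a b.
rewrite (tH (c p) i p (cp p) ip) /= (normal_triv_tjac a (cp p) ip).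
by rewrite (normal_triv_tjac b (cp p) ip) trmx_mul !mulmxA.
Qed.

End NormalBundle.

(** * The lifted foliation of a foliated bundle *)

Section RowBlocks.
Context {R : realType} {V : normedModType R}.

Lemma smooth_on_row_mx (A : set V) m n1 n2 (f : V -> 'M[R]_(m, n1)) (g : V -> 'M[R]_(m, n2)) :
  open A -> smooth_on A f -> smooth_on A g -> smooth_on A (fun z => row_mx (f z) (g z)).
Proof.
move=> oA /(smooth_on_mxP _ oA) sf /(smooth_on_mxP _ oA) sg.
apply/smooth_on_mxP => // i j; under eq_fun do rewrite mxE.
by case: (fintype.split j) => l; [exact: sf|exact: sg].
Qed.

Lemma derive_row_mx m n1 n2 (f : V -> 'M[R]_(m, n1)) (g : V -> 'M[R]_(m, n2)) x v :
  differentiable f x -> differentiable g x ->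
  'D_v (fun z => row_mx (f z) (g z)) x = row_mx ('D_v f x) ('D_v g x).
Proof.
move=> df dg; apply/matrixP => i j; rewrite derive_mxE; last first.
  apply/differentiable_mxP => a b; under eq_fun do rewrite mxE.
  move: df dg => /differentiable_mxP df /differentiable_mxP dg.
  by case: (fintype.split b) => l; [exact: df|exact: dg].
rewrite [RHS]mxE; under eq_fun do rewrite mxE.
by case: (fintype.split j) => l; rewrite (derive_mxE _ _ _ _).
Qed.

Lemma derive_linear_comp m n m' n' (L : {linear 'M[R]_(m, n) -> 'M[R]_(m', n')})
  (f : V -> 'M[R]_(m, n)) x v :
  differentiable f x -> 'D_v (fun z => L (f z)) x = L ('D_v f x).
Proof.
move=> df; rewrite (_ : (fun _ => _) = L \o f) // deriveE.
  rewrite diff_comp //=; last exact: differentiable_linear_mx.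
  by rewrite -!deriveE ?derive_linear_mx //; exact: differentiable_linear_mx.
by apply: differentiable_comp => //; exact: differentiable_linear_mx.
Qed.

End RowBlocks.

Lemma basic_smooth_row_mx {R : realType} {k q : nat} (A : set 'rV[R]_(k + q)) m n1 n2
    (f : 'rV[R]_(k + q) -> 'M[R]_(m, n1)) (g : 'rV[R]_(k + q) -> 'M[R]_(m, n2)) :
  open A -> basic_smooth A f -> basic_smooth A g ->
  basic_smooth A (fun z => row_mx (f z) (g z)).
Proof.
move=> oA /(basic_smooth_mxP _ oA) sf /(basic_smooth_mxP _ oA) sg.
apply/basic_smooth_mxP => // i j; under eq_fun do rewrite mxE.
by case: (fintype.split j) => l; [exact: sf|exact: sg].
Qed.

Lemma foliated_linear {R : realType} {k q k' q' : nat}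
    (L : {linear 'rV[R]_(k + q) -> 'rV[R]_(k' + q')}) A :
  (forall u : 'rV_k, rsubmx (L (row_mx u 0)) = 0) -> foliated_map A L.
Proof.
by move=> L0; split=> [|z _ u]; [exact: smooth_on_linear_mx|rewrite derive_linear_mx].
Qed.

Section Coordinates.
Context {R : realType} {k q m : nat}.

Definition total_coord (z : 'rV[R]_(k + q)) (y : 'rV[R]_m) : 'rV[R]_(k + (q + m)) :=
  row_mx (lsubmx z) (row_mx (rsubmx z) y).

Definition base_proj (Z : 'rV[R]_(k + (q + m))) : 'rV[R]_(k + q) :=
  row_mx (lsubmx Z) (lsubmx (rsubmx Z)).

Definition fiber_proj (Z : 'rV[R]_(k + (q + m))) : 'rV[R]_m := rsubmx (rsubmx Z).

Lemma base_proj_is_linear : linear base_proj.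
Proof. by move=> a x y; rewrite /base_proj !linearP /= scale_row_mx add_row_mx. Qed.
HB.instance Definition _ := GRing.isLinear.Build R _ _ _ base_proj base_proj_is_linear.

Lemma fiber_proj_is_linear : linear fiber_proj.
Proof. by move=> a x y; rewrite /fiber_proj !linearP. Qed.
HB.instance Definition _ := GRing.isLinear.Build R _ _ _ fiber_proj fiber_proj_is_linear.

Lemma base_proj_coord z y : base_proj (total_coord z y) = z.
Proof. by rewrite /base_proj /total_coord !(row_mxKl, row_mxKr) hsubmxK. Qed.

Lemma fiber_proj_coord z y : fiber_proj (total_coord z y) = y.
Proof. by rewrite /fiber_proj /total_coord !row_mxKr. Qed.

Lemma total_coordK Z : total_coord (base_proj Z) (fiber_proj Z) = Z.
Proof. by rewrite /total_coord /base_proj /fiber_proj !(row_mxKl, row_mxKr) !hsubmxK. Qed.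

Lemma base_proj_foliated A : foliated_map A base_proj.
Proof. by apply: foliated_linear => u; rewrite /= /base_proj !row_mxKr linear0. Qed.

Lemma fiber_proj_basic A : basic_smooth A fiber_proj.
Proof.
split=> [|z _ u]; first exact: smooth_on_linear_mx.
by rewrite derive_linear_mx /= /fiber_proj row_mxKr linear0.
Qed.

Lemma base_proj_preimage_open (B : set 'rV[R]_(k + q)) : open B -> open (base_proj @^-1` B).
Proof.
apply: open_comp => Z _.
exact/differentiable_continuous/differentiable_linear_mx.
Qed.

Lemma basic_smooth_base_proj a b B (f : 'rV[R]_(k + q) -> 'M[R]_(a, b)) :
  open B -> basic_smooth B f -> basic_smooth (base_proj @^-1` B) (fun Z => f (base_proj Z)).
Proof.
move=> oB bf; apply: (basic_smooth_comp (base_proj_preimage_open oB) oB) bf _ => //.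
exact: base_proj_foliated.
Qed.

End Coordinates.

Section LiftedAtlas.
Context {R : realType} {M : topologicalType} {k q : nat} {F : fatlas R M k q}.
Context (hF : foliated_atlas F) {m : nat} {E : fbundle F m} (hE : foliated_bundle E).

Definition fiber_transition i j := projT1 (cid (hE.2 i j)).

Lemma fiber_transition_basic i j :
  basic_smooth (chart_img i (cdom (F i) `&` cdom (F j))) (fiber_transition i j).
Proof. by rewrite /fiber_transition; case: cid => T []. Qed.

Lemma fiber_transitionE i j p (a : fiber E p) : cdom (F i) p -> cdom (F j) p ->
  triv j a = triv i a *m fiber_transition i j (F i p).
Proof. by move: a; rewrite /fiber_transition; case: cid => T /= [_ HT] a; exact: HT. Qed.

Implicit Types i j : aidx F.

Let F' := lifted_foliation E.

Definition total_transition i j Z :=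
  total_coord (transition i j (base_proj Z))
    (fiber_proj Z *m fiber_transition i j (base_proj Z)).

Definition total_img i j : set 'rV[R]_(k + (q + m)) :=
  base_proj @^-1` (chart_img i (cdom (F i) `&` cdom (F j))).

Lemma lifted_chartE i (w : total_space E) :
  F' i w = total_coord (F i (projT1 w)) (triv i (projT2 w)).
Proof. by []. Qed.

Lemma total_img_open i j : open (total_img i j).
Proof. by apply: base_proj_preimage_open; exact: chart_img2_open. Qed.

Lemma total_transition_foliated i j : foliated_map (total_img i j) (total_transition i j).
Proof.
have oA : open (total_img i j) by exact: total_img_open.
have oB : open (chart_img i (cdom (F i) `&` cdom (F j))) by exact: chart_img2_open.
have ft := transition_foliated hF i j.
have bb : basic_smooth (total_img i j) (fun Z => fiber_transition i j (base_proj Z)).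
  exact: basic_smooth_base_proj oB (fiber_transition_basic i j).
have bx : basic_smooth (total_img i j) (fun Z => rsubmx (transition i j (base_proj Z))).
  exact: (basic_smooth_base_proj oB ((foliated_mapP _ oB).1 ft).2).
have by_ : basic_smooth (total_img i j)
    (fun Z => fiber_proj Z *m fiber_transition i j (base_proj Z)).
  by apply: basic_smooth_mulmx => //; exact: fiber_proj_basic.
have br := basic_smooth_row_mx oA bx by_.
apply/foliated_mapP => //; split; last first.
  by apply: (basic_smooth_ext oA) br => Z _; rewrite row_mxKr.
apply: smooth_on_row_mx => //; last by case: br.
have st : smooth_on (total_img i j) (fun Z => transition i j (base_proj Z)).
  apply: (smooth_on_comp_mx oA oB) => //; first exact: ft.1.
  exact: smooth_on_linear_mx.
apply/(smooth_on_mxP _ oA) => a b; under eq_fun do rewrite mxE.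
by have /(smooth_on_mxP _ oA) := st; exact.
Qed.

Lemma lifted_inj i : set_inj (cdom (F' i)) (F' i).
Proof.
move=> [p a] [p' a']; rewrite !inE /= => ip ip'.
move=> /[dup] /(congr1 base_proj) + /(congr1 fiber_proj).
rewrite !base_proj_coord !fiber_proj_coord /= => e.
have [_ /(_ p p')] := atlas_chart hF i; rewrite !inE => /(_ ip ip' e) ee _ _.
by subst p'; move=> /((hE.1 i p ip).1 _ _) ->.
Qed.

Lemma lifted_imgP i (U : set M) Z : U `<=` cdom (F i) ->
  (F' i @` [set w | U (projT1 w)]) Z <-> chart_img i U (base_proj Z).
Proof.
move=> Ui; split=> [[w Uw <-]|[p Up e]].
  by rewrite lifted_chartE base_proj_coord; exists (projT1 w).
have [a ea] := (hE.1 i p (Ui p Up)).2 (fiber_proj Z).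
exists (existT _ p a) => //.
by rewrite lifted_chartE /= ea e total_coordK.
Qed.

Lemma lifted_transitionE i j (w : total_space E) : cdom (F' i) w -> cdom (F' j) w ->
  total_transition i j (F' i w) = F' j w.
Proof.
move=> iw jw; rewrite !lifted_chartE /total_transition base_proj_coord fiber_proj_coord.
by rewrite -fiber_transitionE // transitionE.
Qed.

Lemma total_imgE i j : total_img i j = F' i @` (cdom (F' i) `&` cdom (F' j)).
Proof.
rewrite eqEsubset; split=> Z /=.
  by move=> /(lifted_imgP Z (@subIsetl _ _ _)) [w [? ?] <-]; exists w.
by move=> [w [iw jw] <-]; apply/(lifted_imgP _ (@subIsetl _ _ _)); exists w.
Qed.

(** Transition maps of the total space are continuous, so a condition that is
    open in one lifted chart is open in all of them. *)
Lemma lifted_total_open i (N : set 'rV[R]_(k + (q + m))) : open N ->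
  total_open [set w : total_space E | cdom (F' i) w /\ N (F' i w)].
Proof.
move=> oN j w [iw Nw] jw.
have Aw : total_img j i (F' j w) by rewrite total_imgE; exists w.
have c := smooth_on_cont (total_transition_foliated j i).1 Aw.
have nN : \forall z \near F' j w, N (total_transition j i z).
  by apply: c; rewrite lifted_transitionE //; exact: open_nbhs_nbhs.
have nI := open_near (@total_img_open j i) Aw.
near=> z => w' jw' e.
have : total_img j i z by near: z; exact: nI.
rewrite total_imgE => -[w'' [jw'' iw''] e''].
have <- : w'' = w' by apply: (lifted_inj (i := j)); rewrite ?inE // e''.
split=> //; rewrite -(lifted_transitionE jw'' iw'') e''; near: z; exact: nN.
Unshelve. all: by end_near. Qed.

Lemma lifted_is_chart i : is_chart (F' i).
Proof.
split.
- have := @lifted_total_open i _ openT.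
  rewrite (_ : [set _ | _] = cdom (F' i)) //.
  by apply/seteqP; split=> w //= [].
- exact: lifted_inj.
- move=> w iw N; rewrite nbhsE => -[B [oB Bw] BN].
  rewrite /= nbhsE; exists [set w' | cdom (F' i) w' /\ B (F' i w')].
    by split=> //; exact: lifted_total_open.
  by move=> w' [_ /BN].
- move=> V oV Vi; rewrite openE => _ [w Vw <-].
  have iw := Vi w Vw; have nV := oV i w Vw iw.
  have Aw : total_img i i (F' i w) by rewrite total_imgE; exists w.
  have nI := open_near (@total_img_open i i) Aw.
  rewrite /interior; near=> z.
  have : total_img i i z by near: z; exact: nI.
  rewrite total_imgE => -[w' [iw' _] e]; exists w' => //.
  by move: w' iw' e; near: z; apply: filterS nV => z H w' iw' e; exact: H.
Unshelve. all: by end_near. Qed.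

Lemma lifted_smooth_transition i j : smooth_transition (F' i) (F' j).
Proof.
rewrite /smooth_transition /smooth_in_chart setIC -total_imgE.
apply: (smooth_on_ext (@total_img_open i j)) (total_transition_foliated i j).1.
move=> Z; rewrite total_imgE => -[w [iw jw] <-].
by rewrite lifted_transitionE // readE //; exact: lifted_inj.
Qed.

Lemma lifted_foliated_atlas : foliated_atlas F'.
Proof.
split=> [|j i w jw iw].
  split; [exact: lifted_is_chart| |exact: lifted_smooth_transition].
  by move=> w; have [i ip] := atlas_cover hF (projT1 w); exists i.
have oA : open (total_img i j) by exact: total_img_open.
have Aw : total_img i j (F' i w) by rewrite total_imgE; exists w.
have [_ br] := (foliated_mapP _ oA).1 (total_transition_foliated i j).
have := basic_smooth_locally_constant oA br Aw.
have [_ _ /(_ w iw) c _] := lifted_is_chart i.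
move=> /c; have [oj _ _ _] := lifted_is_chart j.
have nj : \forall w' \near w, cdom (F' j) w' by exact: open_near.
apply: filterS2 nj => w' jw' /= H iw' /H.
by rewrite !lifted_transitionE.
Qed.

(** The fiber coordinates change by [y *m T x], to be differentiated with the
    Leibniz rule. *)
Lemma lifted_tjac i j (w : total_space E) (v : 'rV[R]_q) (y : 'rV[R]_m) :
  cdom (F' i) w -> cdom (F' j) w -> let z := F i (projT1 w) in
  row_mx v y *m tjac_transition (F := F') i j (F' i w) =
  row_mx (v *m tjac_transition i j z)
    (y *m fiber_transition i j z +
     triv i (projT2 w) *m 'D_(row_mx 0 v) (fiber_transition i j) z).
Proof.
move=> iw jw z; set V := row_mx v y; set Z := F' i w.
have Aw : total_img i j Z by rewrite total_imgE; exists w.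
have oA : open (total_img i j) by exact: total_img_open.
have oB : open (chart_img i (cdom (F i) `&` cdom (F j))) by exact: chart_img2_open.
have Bz : chart_img i (cdom (F i) `&` cdom (F j)) z by exists (projT1 w).
have ft := total_transition_foliated i j.
have -> : tjac_transition (F := F') i j Z = tjac (total_transition i j) Z.
  apply: (tjac_ext oA Aw) => Y; rewrite total_imgE => -[w' [iw' jw'] <-].
  by rewrite (transitionE lifted_foliated_atlas) // lifted_transitionE.
have eV : V = rsubmx (row_mx 0 V : 'rV[R]_(k + (q + m))) by rewrite row_mxKr.
rewrite {1}eV -(tjacE _ ft Aw).
set D := row_mx 0 V.
have [sr br] := (foliated_mapP _ oA).1 ft.
have rD : rsubmx ('D_D (total_transition i j) Z) =
    'D_D (fun Y => rsubmx (total_transition i j Y)) Z.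
  by rewrite (derive_linear_comp (rsubmx : {linear _ -> _})) //; exact: smooth_on_diff sr Aw.
have bZ : base_proj Z = z by rewrite /Z lifted_chartE base_proj_coord.
have bD : base_proj D = row_mx 0 v by rewrite /base_proj /D /V row_mxKl row_mxKr row_mxKl.
have bx : basic_smooth (total_img i j) (fun Z => rsubmx (transition i j (base_proj Z))).
  exact: (basic_smooth_base_proj oB ((foliated_mapP _ oB).1 (transition_foliated hF i j)).2).
have bb : basic_smooth (total_img i j) (fun Z => fiber_transition i j (base_proj Z)).
  exact: basic_smooth_base_proj oB (fiber_transition_basic i j).
have db := smooth_on_diff bb.1 Aw.
have df := smooth_on_diff (fiber_proj_basic (total_img i j)).1 Aw.
have dbp : differentiable (base_proj : _ -> 'rV[R]_(k + q)) Z.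
  by exact: differentiable_linear_mx.
have by_ : basic_smooth (total_img i j)
    (fun Z => fiber_proj Z *m fiber_transition i j (base_proj Z)).
  by apply: basic_smooth_mulmx => //; exact: fiber_proj_basic.
rewrite rD (derive_ext (g := fun Y => row_mx (rsubmx (transition i j (base_proj Y)))
  (fiber_proj Y *m fiber_transition i j (base_proj Y))) D oA) //; last first.
  by move=> Y _; rewrite /total_transition /total_coord row_mxKr.
rewrite derive_row_mx; last 2 first.
- exact: smooth_on_diff bx.1 Aw.
- exact: smooth_on_diff by_.1 Aw.
have dt : differentiable (transition i j) (base_proj Z).
  by rewrite bZ; exact: smooth_on_diff (transition_foliated hF i j).1 Bz.
have dB : differentiable (fiber_transition i j) (base_proj Z).
  by rewrite bZ; exact: smooth_on_diff (fiber_transition_basic i j).1 Bz.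
congr row_mx.
  rewrite (derive_linear_comp (rsubmx : {linear _ -> _})
    (f := fun Y => transition i j (base_proj Y))); last first.
    exact: differentiable_comp dbp dt.
  rewrite (derive_comp D dt dbp) derive_linear_mx /= bD bZ.
  by rewrite (tjacE _ (transition_foliated hF i j) Bz) row_mxKr.
rewrite (derive_mulmx D df db) derive_linear_mx (derive_comp D dB dbp) derive_linear_mx /=.
by rewrite bD bZ /fiber_proj /D /V !row_mxKr.
Qed.

End LiftedAtlas.

(** * Restriction to the zero section *)

Section ZeroSection.
Context {R : realType}.

Lemma ulsubmx_form q m (A : 'M[R]_(q + m)) (y z : 'rV[R]_q) :
  y *m ulsubmx A *m z^T = row_mx y 0 *m A *m (row_mx z 0)^T.
Proof.
rewrite -{2}[A]submxK mul_row_block !mul0mx !addr0 tr_row_mx mul_row_col.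
by rewrite trmx0 mulmx0 addr0.
Qed.

Definition zero_coord {k q m} (z : 'rV[R]_(k + q)) : 'rV[R]_(k + (q + m)) := total_coord z 0.

Lemma zero_coord_is_linear k q m : linear (@zero_coord k q m).
Proof.
move=> a x y; rewrite /zero_coord /total_coord !linearP /=.
by rewrite !scale_row_mx !add_row_mx scaler0 addr0.
Qed.
HB.instance Definition _ k q m :=
  GRing.isLinear.Build R _ _ _ (@zero_coord k q m) (@zero_coord_is_linear k q m).

Lemma zero_coord_foliated k q m A : foliated_map A (@zero_coord k q m).
Proof.
apply: foliated_linear => u; rewrite /= /zero_coord /total_coord.
by rewrite !row_mxKr row_mx0.
Qed.

(** The zero section is transverse to the fibers and maps leaves to leaves, so
    it pulls a transverse metric of the total space back to the base. *)
Lemma riemannian_of_lifted (M : topologicalType) k q (F : fatlas R M k q) m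
    (E : fbundle F m) : foliated_atlas F -> foliated_bundle E ->
  riemannian (lifted_foliation E) -> riemannian F.
Proof.
move=> hF hE /(riemannianP (lifted_foliated_atlas hF hE)) [H [bH pH tH]].
apply/(riemannianP hF).
have w0 i p : cdom (F i) p -> exists w : total_space E,
    [/\ projT1 w = p, cdom (lifted_foliation E i) w &
        forall j, cdom (F j) p -> lifted_foliation E j w = zero_coord (F j p)].
  move=> ip; have [a a0] := (hE.1 i p ip).2 0.
  exists (existT _ p a); split=> // j jp.
  by rewrite lifted_chartE /= (fiber_transitionE hE a ip jp) a0 mul0mx.
exists (fun i z => ulsubmx (H i (zero_coord z))); split=> [i|i p ip|i j p ip jp].
- have oA : open (chart_img i (cdom (F i))) by apply: chart_img_open => //; exact: cdom_open.
  have oB : open (chart_img (F := lifted_foliation E) i (cdom (lifted_foliation E i))).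
    apply: (chart_img_open (lifted_foliated_atlas hF hE)) => //.
    exact: (cdom_open (lifted_foliated_atlas hF hE)).
  have b0 : basic_smooth (chart_img i (cdom (F i))) (fun z => H i (zero_coord z)).
    apply: (basic_smooth_comp oA oB _ (bH i) (@zero_coord_foliated _ _ _ _)).
    by move=> _ [p ip <-]; have [w [_ iw e]] := w0 i p ip; exists w => //; exact: e.
  have b1 := @basic_smooth_linear _ _ _ _ _ _ _ usubmx _ _ oA b0.
  exact: (@basic_smooth_linear _ _ _ _ _ _ _ lsubmx _ _ oA b1).
- have [w [_ iw e]] := w0 i p ip; have [sy po] := pH i w iw.
  rewrite (e i ip) in sy po; split=> [|y y0].
    by rewrite trmx_ulsub sy.
  rewrite ulsubmx_form; apply: po; apply: contraNneq y0 => /eqP.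
  by rewrite row_mx_eq0 => /andP[].
have [w [wp iw e]] := w0 i p ip.
have jw : cdom (lifted_foliation E j) w by rewrite /= wp.
have := tH i j w iw jw; rewrite (e i ip) (e j jp) => E1.
apply: form_eq => y z; rewrite ulsubmx_form E1 !mulmxA.
have K (v : 'rV[R]_q) :
    row_mx v 0 *m tjac_transition (F := lifted_foliation E) i j (zero_coord (F i p)) =
    row_mx (v *m tjac_transition i j (F i p)) 0.
  have y0 : triv i (projT2 w) = 0.
    by rewrite -[LHS](fiber_proj_coord (F i (projT1 w))) -lifted_chartE e // fiber_proj_coord.
  by rewrite -(e i ip) (lifted_tjac hF hE v 0 iw jw) y0 !mul0mx addr0 wp.
rewrite K -(mulmxA _ _ (row_mx z 0)^T) -trmx_mul K.
by rewrite -ulsubmx_form trmx_mul !mulmxA.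
Qed.

End ZeroSection.

(** * Iterated transverse derivatives *)

Section Words.
Context {R : realType} {k q : nat}.

(** Words of directions replace multi-indices in the computations, because a
    further derivative just adds a letter; [wderiv_perm] and [exists_mword] lead
    back to multi-indices. *)
Definition wderiv {W : normedModType R} (w : seq 'I_q) (f : 'rV[R]_(k + q) -> W) :=
  foldr (fun b g => 'D_(xdir b) g) f w.

Lemma wderiv_basic m n A (w : seq 'I_q) (f : 'rV[R]_(k + q) -> 'M[R]_(m, n)) :
  open A -> basic_smooth A f -> basic_smooth A (wderiv w f).
Proof. by move=> oA bf; elim: w => //= b w IH; exact: basic_smooth_derive. Qed.

Lemma wderiv_ext (W : normedModType R) A w (f g : 'rV[R]_(k + q) -> W) : open A ->
  (forall z, A z -> f z = g z) -> forall z, A z -> wderiv w f z = wderiv w g z.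
Proof.
by move=> oA fg; elim: w => //= b w IH z Az; exact: derive_ext oA IH Az.
Qed.

Lemma derive_comm_mx m n A (f : 'rV[R]_(k + q) -> 'M[R]_(m, n)) v w z :
  open A -> smooth_on A f -> A z -> 'D_v ('D_w f) z = 'D_w ('D_v f) z.
Proof.
move=> oA sf Az; apply/matrixP => i j.
have E u1 u2 : ('D_u1 ('D_u2 f) z) i j = 'D_u1 ('D_u2 (fun y => f y i j)) z.
  rewrite derive_mxE; last exact: smooth_on_diff (smooth_on_derive _ sf) Az.
  by apply: (derive_ext _ oA _ Az) => y Ay; rewrite derive_mxE //; exact: smooth_on_diff sf Ay.
apply: etrans (E v w) _; apply: etrans (esym (E w v)).
apply: (derive_comm _ _ oA _ Az).
by have /(smooth_on_mxP _ oA) := sf; exact.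
Qed.

Lemma wderiv_rem m n A (w : seq 'I_q) b (f : 'rV[R]_(k + q) -> 'M[R]_(m, n)) z :
  open A -> basic_smooth A f -> A z -> b \in w ->
  wderiv w f z = wderiv (b :: rem b w) f z.
Proof.
move=> oA bf; elim: w z => //= c w IH z Az; rewrite in_cons.
have [->|_ /= bw] := eqVneq c b; first by [].
have e y : A y -> wderiv w f y = 'D_(xdir b) (wderiv (rem b w) f) y.
  by move=> Ay; exact: IH.
rewrite (derive_ext _ oA e Az); apply: (derive_comm_mx _ _ oA _ Az).
by case: (wderiv_basic (rem b w) oA bf).
Qed.

Lemma wderiv_perm m n A (w w' : seq 'I_q) (f : 'rV[R]_(k + q) -> 'M[R]_(m, n)) z :
  open A -> basic_smooth A f -> A z -> perm_eq w w' -> wderiv w f z = wderiv w' f z.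
Proof.
move=> oA bf; elim: w w' z => [|b w IH] w' z Az pe.
  by move: pe; rewrite perm_sym => /perm_nilP ->.
have bw' : b \in w' by rewrite -(perm_mem pe) mem_head.
rewrite (wderiv_rem oA bf Az bw') /=.
apply: (derive_ext _ oA _ Az) => y Ay; apply: IH => //.
by rewrite -(perm_cons b); apply: perm_trans pe (perm_to_rem bw').
Qed.

Context {r : nat}.

Definition mword (a : multi_index (q := q) r) : seq 'I_q :=
  flatten [seq nseq (sval a b) b | b <- enum 'I_q].

Lemma partial_xE m a (f : 'rV[R]_(k + q) -> 'rV[R]_m) : partial_x a f = wderiv (mword a) f.
Proof.
rewrite /partial_x /mword; elim: (enum 'I_q) => //= b s ->.
by rewrite /wderiv foldr_cat; elim: (nat_of_ord (sval a b)) => //= n ->.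
Qed.

Lemma count_mword a b : count_mem b (mword a) = sval a b.
Proof.
rewrite /mword count_flatten -map_comp sumnE big_map big_enum /=.
rewrite (bigD1 b) //= count_nseq /= eqxx mul1n big1 ?addn0 // => c cb.
by rewrite count_nseq /= (negbTE cb).
Qed.

Lemma size_sum_count (w : seq 'I_q) : size w = (\sum_(b < q) count_mem b w)%N.
Proof.
elim: w => /= [|c w ->]; first by rewrite big1.
rewrite big_split /=; suff -> : (\sum_(b < q) (c == b) = 1)%N by [].
rewrite (bigD1 c) //= eqxx big1 // => b /negbTE.
by rewrite eq_sym => ->.
Qed.

Lemma size_mword a : (size (mword a) <= r)%N.
Proof.
rewrite size_sum_count; apply: leq_trans (svalP a).
by under eq_bigr do rewrite count_mword.
Qed.

Lemma exists_mword (w : seq 'I_q) : (size w <= r)%N ->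
  exists a : multi_index r, perm_eq w (mword a).
Proof.
move=> wr; pose f : {ffun 'I_q -> 'I_r.+1} := [ffun b => inord (count_mem b w)].
have fE b : f b = count_mem b w :> nat.
  by rewrite ffunE inordK // ltnS; apply: leq_trans (count_size _ _) wr.
have fr : (\sum_(b < q) f b <= r)%N by under eq_bigr do rewrite fE; rewrite -size_sum_count.
pose a : multi_index r := exist _ f fr.
exists a; rewrite /perm_eq; apply/allP => b _ /=.
by rewrite count_mword /= fE.
Qed.

End Words.

(** * Functions with prescribed derivatives *)

Section Monomials.
Context {R : realType}.

(** The [c]-th derivative of the divided power [t ^ n / n!]. Differentiation only
    increments [c], and the value at 0 is 0 or 1. *)
Definition dmonom (n c : nat) (t : R) : R :=
  if (c <= n)%N then t ^+ (n - c) / (n - c)`!%:R else 0.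

Lemma dmonom0 n c : dmonom n c 0 = (c == n)%:R.
Proof.
rewrite /dmonom expr0n subn_eq0; case: ltngtP => // [cn|->]; first by rewrite mul0r.
by rewrite subnn fact0 divr1.
Qed.

Lemma derive_dmonom (V : normedModType R) (f : V -> R) n c x v :
  differentiable f x ->
  derivable (fun y => dmonom n c (f y)) x v /\
  'D_v (fun y => dmonom n c (f y)) x = dmonom n c.+1 (f x) * 'D_v f x.
Proof.
move=> df; have dv := diff_derivable (v := v) df; rewrite /dmonom.
case: (ltngtP c n) => [cn|nc|->]; last 2 first.
- by split; [exact: derivable_cst|rewrite derive_cst mul0r].
- rewrite subnn; under eq_fun do rewrite expr0 fact0 divr1.
  by split; [exact: derivable_cst|rewrite derive_cst mul0r].
have e : (fun y => f y ^+ (n - c) / (n - c)`!%:R) = (n - c)`!%:R^-1 *: (f ^+ (n - c)).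
  apply/funext => y; rewrite mulrC; congr (_ * _).
  by elim: (n - c)%N => [|l IH]; rewrite ?expr0 // !exprS IH.
rewrite e; split; first by apply: derivableZ; exact: derivableX.
rewrite deriveZ ?deriveX //; last exact: derivableX.
have -> : (n - c = (n - c.+1).+1)%N by rewrite subnSK.
rewrite /= factS natrM /GRing.scale /= mulrA; congr (_ * _).
have n1 : ((n - c.+1).+1%:R : R) != 0 by rewrite pnatr_eq0.
have n2 : ((n - c.+1)`!%:R : R) != 0 by rewrite pnatr_eq0 -lt0n fact_gt0.
move: ((n - c.+1).+1%:R : R) ((n - c.+1)`!%:R : R) n1 n2 => p p' n1 n2.
by move: (f x ^+ _) => t; field; rewrite n1 n2.
Qed.

Context {k q : nat}.
Context (x0 : 'rV[R]_(k + q)).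

Definition monom (a c : 'I_q -> nat) (z : 'rV[R]_(k + q)) : R :=
  \prod_b dmonom (a b) (c b) (z 0 (rshift k b) - x0 0 (rshift k b)).

Lemma monom_center a c : monom a c x0 = [forall b, c b == a b]%:R.
Proof.
rewrite /monom; under eq_bigr do rewrite subrr dmonom0.
case: forallP => [H|/forallP]; first by rewrite big1 // => b _; rewrite H.
by rewrite negb_forall => /existsP [b /negbTE cb]; rewrite (bigD1 b) //= cb mul0r.
Qed.

Lemma differentiable_coordB b z :
  differentiable (fun y : 'rV[R]_(k + q) => y 0 (rshift k b) - x0 0 (rshift k b)) z.
Proof.
apply: differentiableB; last exact: differentiable_cst.
exact: differentiable_coord.
Qed.

Lemma derive_coordB b d z :
  'D_(xdir d) (fun y : 'rV[R]_(k + q) => y 0 (rshift k b) - x0 0 (rshift k b)) z =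
  (b == d)%:R.
Proof.
rewrite deriveB ?derive_cst ?subr0; last 2 first.
- exact/diff_derivable/differentiable_coord.
- exact: derivable_cst.
have <- := derive_mxE (xdir d) 0 (rshift k b) (differentiable_linear_mx idfun z).
by rewrite derive_linear_mx /= /xdir row_mxEr mxE eqxx eq_sym.
Qed.

Lemma smooth_dmonom n c b :
  smooth_on setT (fun y : 'rV[R]_(k + q) =>
    dmonom n c (y 0 (rshift k b) - x0 0 (rshift k b))).
Proof.
rewrite /dmonom; case: leqP => _; last exact: smooth_on_cst.
apply: smooth_onM; [exact: openT| |exact: smooth_on_cst].
elim: (n - c)%N => [|l IH].
  by under eq_fun do rewrite expr0; exact: smooth_on_cst.
under eq_fun do rewrite exprS; apply: smooth_onM => //; first exact: openT.
apply: smooth_onD; [exact: openT| |exact: smooth_on_cst].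
exact: smooth_on_coord.
Qed.

Lemma smooth_monom a c : smooth_on setT (monom a c).
Proof. by apply: smooth_on_prod => [|b]; [exact: openT|exact: smooth_dmonom]. Qed.

(** The factors other than the one of the direction [d] are constant along it. *)
Lemma derive_monom a c d z :
  'D_(xdir d) (monom a c) z = monom a (fun b => (c b + (b == d))%N) z.
Proof.
pose t b (y : 'rV[R]_(k + q)) := y 0 (rshift k b) - x0 0 (rshift k b).
pose rest (y : 'rV[R]_(k + q)) := \prod_(b < q | b != d) dmonom (a b) (c b) (t b y).
have e : monom a c = (fun y => dmonom (a d) (c d) (t d y)) * rest.
  by apply/funext => y; rewrite /monom (bigD1 d).
have restl h : rest (h *: xdir d + z) = rest z.
  apply: eq_bigr => b bd; congr dmonom; rewrite /t; congr (_ - _).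
  have xb : xdir d 0 (rshift k b) = 0 :> R.
    by rewrite /xdir row_mxEr mxE (negbTE bd) andbF.
  by rewrite 2!mxE xb mulr0 add0r.
have D0 : 'D_(xdir d) rest z = 0.
  exact: derive_along_cst.
have Dr : derivable rest z (xdir d).
  apply: (smooth_on_derivable (A := setT)) => //.
  rewrite /rest; under eq_fun do rewrite big_mkcond /=.
  apply: smooth_on_prod => [|b]; first exact: openT.
  by case: (b != d); [exact: smooth_dmonom|exact: smooth_on_cst].
have [D1 E1] := derive_dmonom (a d) (c d) (xdir d) (differentiable_coordB d z).
rewrite e deriveM // D0 scaler0 add0r E1 derive_coordB eqxx mulr1.
rewrite /monom [RHS](bigD1 d) //= eqxx addn1 mulrC; congr (_ * _).
by apply: eq_bigr => b /negbTE ->; rewrite addn0.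
Qed.

Lemma wderiv_monom_sum (I : finType) (a : I -> 'I_q -> nat) m (y : I -> 'rV[R]_m)
    (w : seq 'I_q) :
  wderiv w (fun z => \sum_l monom (a l) (fun=> 0%N) z *: y l) =
  (fun z => \sum_l monom (a l) (fun b => count_mem b w) z *: y l).
Proof.
elim: w => [|d w /= ->]; first by [].
apply/funext => z.
have dm l : differentiable (monom (a l) (fun b => count_mem b w)) z.
  exact: smooth_on_diff (smooth_monom _ _) _.
rewrite derive_fsum => [|l]; last exact: differentiableZl.
apply: eq_bigr => l _; rewrite derive_scalel // derive_monom; congr (monom _ _ _ *: _).
by apply/funext => b; rewrite addnC eq_sym.
Qed.

End Monomials.

(** * Jet bundles are foliated bundles *)

Section JetTransition.
Context {R : realType} {M : topologicalType} {k q : nat} {F : fatlas R M k q}.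
Context (hF : foliated_atlas F) {m : nat}.
Context (i j : aidx F) (T : 'rV[R]_(k + q) -> 'M[R]_m).
Let A := chart_img i (cdom (F i) `&` cdom (F j)).
Context (bT : basic_smooth A T).

(** The inverse of the transverse Jacobian, in a form that is visibly smooth. *)
Definition jac_back (z : 'rV[R]_(k + q)) := tjac_transition j i (transition i j z).

Lemma jac_back_basic : basic_smooth A jac_back.
Proof.
apply: (basic_smooth_comp _ _ _ (tjac_transition_basic hF j i) (transition_foliated hF i j)).
- exact: chart_img2_open.
- exact: chart_img2_open.
- by move=> _ [p [ip jp] <-]; exists p => //; rewrite transitionE.
Qed.

(** Write [g] as [h] composed with the transition back to the first chart: as
    [h] is basic, the chain rule involves transverse derivatives only. *)
Lemma derive_x_transition (W : normedModType R) (U : set M) (g : 'rV[R]_(k + q) -> W)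
    (h : 'rV[R]_(k + q) -> W) b p :
  open U -> U `<=` cdom (F i) `&` cdom (F j) -> U p ->
  basic_smooth (chart_img i U) h ->
  (forall p, U p -> g (F j p) = h (F i p)) ->
  'D_(xdir b) g (F j p) =
  \sum_d jac_back (F i p) b d *: 'D_(xdir d) h (F i p).
Proof.
move=> oU Uij Up bh gh.
have [Ui Uj] : U `<=` cdom (F i) /\ U `<=` cdom (F j) by split=> y /Uij [].
have [ip jp] := Uij p Up.
have oB' : open (chart_img j U) by exact: chart_img_open.
have B'p : chart_img j U (F j p) by exists p.
have ft : foliated_map (chart_img j U) (transition j i).
  apply: foliated_mapS (transition_foliated hF j i) => _ [y Uy <-].
  by exists y => //; split; [exact: Uj|exact: Ui].
rewrite (derive_ext (g := fun y => h (transition j i y)) _ oB') //; last first.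
  by move=> _ [y Uy <-]; rewrite transitionE ?gh //; exact: Uj.
rewrite (derive_basic_comp _ (B := chart_img i U) _ bh ft B'p); last first.
  by move=> _ [y Uy <-]; rewrite transitionE //; [exists y|exact: Uj].
rewrite transitionE // /xdir row_mxKr derive_xE; last first.
  by apply: smooth_on_diff bh.1 _; exists p.
apply: eq_bigr => d _; congr (_ *: _).
by rewrite /jac_back transitionE // -rowE mxE.
Qed.

(** By induction on the word: a further derivative falls either on [f], which
    lengthens a word by one letter, or on a coefficient. Only the existence of
    basic coefficients matters, so they are left as an unspecified finite
    family. *)
Lemma wderiv_transition (w : seq 'I_q) :
  exists (I : finType) (ws : I -> seq 'I_q) (cs : I -> 'rV[R]_(k + q) -> 'M[R]_m),
  [/\ (forall l, (size (ws l) <= size w)%N),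
      (forall l, basic_smooth A (cs l)) &
      forall (U : set M) (f g : 'rV[R]_(k + q) -> 'rV[R]_m),
        open U -> U `<=` cdom (F i) `&` cdom (F j) ->
        basic_smooth (chart_img i U) f ->
        (forall p, U p -> g (F j p) = f (F i p) *m T (F i p)) ->
        forall p, U p -> wderiv w g (F j p) =
          \sum_l wderiv (ws l) f (F i p) *m cs l (F i p)].
Proof.
have oA : open A by exact: chart_img2_open.
elim: w => [|b w [I [ws [cs [sz bc H]]]]].
  exists unit, (fun=> [::]), (fun=> T); split=> // U f g oU Uij bf fg p Up.
  by rewrite (big_pred1 tt) => [|[]//]; exact: fg.
exists (('I_q * I) + ('I_q * I))%type,
  (fun x => match x with inl y => y.1 :: ws y.2 | inr y => ws y.2 end),
  (fun x z => match x with
     | inl y => jac_back z b y.1 *: cs y.2 z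
     | inr y => jac_back z b y.1 *: 'D_(xdir y.1) (cs y.2) z end).
have bJ d : basic_smooth A (fun z => jac_back z b d).
  by have /(basic_smooth_mxP _ oA) := jac_back_basic; exact.
have bZ d c : basic_smooth A c -> basic_smooth A (fun z => jac_back z b d *: c z : 'M[R]_m).
  move=> /(basic_smooth_mxP _ oA) bc'; apply/basic_smooth_mxP => // a e.
  by under eq_fun do rewrite mxE; exact: basic_smoothM.
split=> [[] [d l]|[] [d l]|U f g oU Uij bf fg p Up].
- by rewrite /= ltnS.
- exact: leq_trans (sz l) (leqnSn _).
- exact: bZ.
- by apply: bZ; exact: basic_smooth_derive.
have Ui : U `<=` cdom (F i) by move=> y /Uij [].
have oB : open (chart_img i U) by exact: chart_img_open.
have BA : chart_img i U `<=` A by move=> _ [y Uy <-]; exists y => //; exact: Uij.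
have Bp : chart_img i U (F i p) by exists p.
have bw l : basic_smooth (chart_img i U) (wderiv (ws l) f) by exact: wderiv_basic.
have bcU l : basic_smooth (chart_img i U) (cs l) by exact: basic_smoothS BA (bc l).
pose h z := \sum_l wderiv (ws l) f z *m cs l z.
have bh : basic_smooth (chart_img i U) h.
  by apply: basic_smooth_sum => // l; exact: basic_smooth_mulmx.
have E := @derive_x_transition _ U (wderiv w g) h b p oU Uij Up bh (H U f g oU Uij bf fg).
rewrite [LHS]E /h.
rewrite big_sumType /=.
rewrite -(pair_bigA _ (fun d l => wderiv (d :: ws l) f (F i p) *m
  (jac_back (F i p) b d *: cs l (F i p)))).
rewrite -(pair_bigA _ (fun d l => wderiv (ws l) f (F i p) *m
  (jac_back (F i p) b d *: 'D_(xdir d) (cs l) (F i p)))).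
rewrite -big_split /=.
apply: eq_bigr => d _; rewrite derive_fsum => [|l]; last first.
  exact: smooth_on_diff (basic_smooth_mulmx oB (bw l) (bcU l)).1 Bp.
rewrite scaler_sumr -big_split /=; apply: eq_bigr => l _.
rewrite derive_mulmx; last 2 first.
- exact: smooth_on_diff (bw l).1 Bp.
- exact: smooth_on_diff (bcU l).1 Bp.
by rewrite scalerDr -!scalemxAr.
Qed.

Lemma partial_x_transition r (a : multi_index r) :
  exists C : multi_index r -> 'rV[R]_(k + q) -> 'M[R]_m,
  (forall a', basic_smooth A (C a')) /\
  forall (U : set M) (f g : 'rV[R]_(k + q) -> 'rV[R]_m),
    open U -> U `<=` cdom (F i) `&` cdom (F j) ->
    basic_smooth (chart_img i U) f ->
    (forall p, U p -> g (F j p) = f (F i p) *m T (F i p)) ->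
    forall p, U p -> partial_x a g (F j p) =
      \sum_(a' : multi_index r) partial_x a' f (F i p) *m C a' (F i p).
Proof.
have oA : open A by exact: chart_img2_open.
have [I [ws [cs [sz bc H]]]] := wderiv_transition (mword a).
have szr l : (size (ws l) <= r)%N by apply: leq_trans (sz l) (size_mword a).
pose c l := projT1 (cid (exists_mword (szr l))).
have cP l : perm_eq (ws l) (mword (c l)) by rewrite /c; case: cid.
exists (fun a' z => \sum_(l | c l == a') cs l z); split=> [a'|U f g oU Uij bf fg p Up].
  under eq_fun do rewrite big_mkcond /=.
  apply: basic_smooth_sum => // l; case: (_ == _) => //; exact: basic_smooth_cst.
have Ui : U `<=` cdom (F i) by move=> y /Uij [].
have oB : open (chart_img i U) by exact: chart_img_open.
have Bp : chart_img i U (F i p) by exists p.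
rewrite partial_xE (H U f g oU Uij bf fg p Up) (partition_big c predT) //=.
apply: eq_bigr => a' _; rewrite mulmx_sumr; apply: eq_bigr => l /eqP <-.
by rewrite partial_xE (wderiv_perm oB bf Bp (cP l)).
Qed.

End JetTransition.

Section JetBundle.
Context {R : realType} {M : topologicalType} {k q : nat} {F : fatlas R M k q}.
Context (hF : foliated_atlas F) {m : nat} {E : fbundle F m} (hE : foliated_bundle E).
Context (r : nat).

Lemma component_basic i (s : forall p, fiber E p) V : open V -> V `<=` cdom (F i) ->
  foliated_section V s -> basic_smooth (chart_img i V) (read (F i) (component i s)).
Proof.
move=> oV Vi /(_ i); rewrite setIidl // => -[fs bs].
exact: read_of_fsmooth_basic.
Qed.

Lemma foliated_sectionS (U V : set M) (s : forall p, fiber E p) :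
  open U -> U `<=` V -> foliated_section V s -> foliated_section U s.
Proof.
move=> oU UV sV i; have [fs bs] := sV i; split=> l.
  apply: smooth_onS (fs l) => _ [p [[Up ip] lp] <-]; exists p => //.
  by split=> //; split=> //; exact: UV.
by move=> p [Up ip] lp; apply: bs => //; split=> //; exact: UV.
Qed.

Lemma xderiv_transition i j (a : multi_index r) :
  exists C : multi_index r -> 'rV[R]_(k + q) -> 'M[R]_m,
  (forall a', basic_smooth (chart_img i (cdom (F i) `&` cdom (F j))) (C a')) /\
  forall p (s : forall p, fiber E p), foliated_near p s -> cdom (F i) p -> cdom (F j) p ->
    xderiv j a s p = \sum_(a' : multi_index r) xderiv i a' s p *m C a' (F i p).
Proof.
have [C [bC H]] := partial_x_transition hF (fiber_transition_basic hE i j) a.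
exists C; split=> // p s [V [oV Vp sV]] ip jp.
pose U := V `&` (cdom (F i) `&` cdom (F j)).
have oU : open U by apply: openI => //; exact: dom2_open.
have sU : foliated_section U s by apply: foliated_sectionS sV => // y [].
apply: (H U) => //.
- by move=> y [].
- by apply: component_basic => // y [_ []].
- by move=> y [_ [iy jy]]; rewrite !readF //; exact: fiber_transitionE.
Qed.

Lemma jet_trivE i p (C : jet_fiber E r p) s : sval C = jet_class r p s -> cdom (F i) p ->
  jet_triv i C = \row_l (xderiv i (enum_val l).1 s p 0 (enum_val l).2).
Proof.
move=> Cs ip; rewrite /jet_triv; case: (cid _) => t /= [ft Ct].
have [_ st] : jet_class r p s t by rewrite -Cs Ct.
by apply/rowP => l; rewrite !mxE st.
Qed.

Lemma same_jet_of_chart i p (s t : forall p, fiber E p) :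
  foliated_near p s -> foliated_near p t -> cdom (F i) p ->
  (forall a : multi_index r, xderiv i a s p = xderiv i a t p) -> same_jet r p s t.
Proof.
move=> fs ft ip e j jp a; have [C [_ H]] := xderiv_transition i j a.
by rewrite !H //; apply: eq_bigr => a' _; rewrite e.
Qed.

Lemma jet_class_eq p (s t : forall p, fiber E p) : same_jet r p s t ->
  jet_class r p s = jet_class r p t.
Proof.
move=> st; apply/seteqP; split=> x [fx sx]; split=> // i ip a.
  by rewrite -sx // st.
by rewrite st // sx.
Qed.

(** A combination of divided powers centered at the given point has the
    required derivatives there. *)
Lemma exists_section i p (y : multi_index r -> 'rV[R]_m) : cdom (F i) p ->
  exists s : forall p, fiber E p, foliated_near p s /\
    forall a, xderiv i a s p = y a.
Proof.
move=> ip; pose x0 := F i p.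
pose f z := \sum_(a : multi_index r) monom x0 (fun b => sval a b) (fun=> 0%N) z *: y a.
have ex p' : exists a : fiber E p', cdom (F i) p' -> triv i a = f (F i p').
  have [ip'|nip'] := pselect (cdom (F i) p').
    by have [a ea] := (hE.1 i p' ip').2 (f (F i p')); exists a.
  (* Outside the chart any element of the fiber will do. *)
  have [j jp'] := atlas_cover hF p'; have [a _] := (hE.1 j p' jp').2 0.
  by exists a.
pose s p' := projT1 (cid (ex p')).
have sE p' : cdom (F i) p' -> triv i (s p') = f (F i p').
  by rewrite /s; case: cid.
have oA : open (chart_img i (cdom (F i))) by apply: chart_img_open => //; exact: cdom_open.
have bf : basic_smooth (chart_img i (cdom (F i))) f.
  apply: basic_smooth_sum => // a; apply/basic_smooth_mxP => // l l'.
  under eq_fun do rewrite mxE; apply: basic_smoothM => //; last exact: basic_smooth_cst.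
  split; first exact: smooth_onS (@subsetT _ _) (smooth_monom _ _ _).
  move=> z _ u; apply: derive_along_cst => h; apply: eq_bigr => b _.
  by congr (dmonom _ _ (_ - _)); rewrite 2!mxE row_mxEr mxE mulr0 add0r.
exists s; split.
  exists (cdom (F i)); split=> //; first exact: cdom_open.
  move=> j; pose U := cdom (F i) `&` cdom (F j).
  have oU : open U by exact: dom2_open.
  have oB : open (chart_img i U) by exact: chart_img2_open.
  apply: (fsmooth_basic_of_read hF (i := i) oU (@subIsetl _ _ _)
    (H := fun z => f z *m fiber_transition hE i j z)).
    apply: basic_smooth_mulmx => //; last exact: fiber_transition_basic.
    by apply: basic_smoothS bf => _ [y' [iy _] <-]; exists y'.
  by move=> y' [iy jy]; rewrite /component (fiber_transitionE hE _ iy jy) sE.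
move=> a; rewrite /xderiv partial_xE (wderiv_ext (g := f) _ oA); last first.
- by exists p.
- by move=> _ [y' iy <-]; rewrite readF // /component sE.
rewrite wderiv_monom_sum (bigD1 a) //= monom_center.
rewrite (introT forallP) => [|b]; last by rewrite count_mword.
rewrite scale1r big1 ?addr0 // => a' a'a; rewrite monom_center.
case: forallP => [H|_]; last by rewrite scale0r.
case/eqP: a'a; apply: eq_sval; apply/ffunP => b; apply: val_inj.
by have /eqP := H b; rewrite count_mword.
Qed.

(** A jet is determined by the derivatives in one chart, which can be arbitrary
    and depend linearly, with basic coefficients, on those in another. *)
Lemma jet_bundle_foliated : foliated_bundle (jet_bundle E r).
Proof.
split=> [i p ip|i j].
  split=> [C D|y].
    have [s [fs Cs]] := svalP C; have [t [ft Dt]] := svalP D.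
    rewrite /= (jet_trivE Cs ip) (jet_trivE Dt ip) => /rowP e.
    apply: eq_sval; rewrite Cs Dt; apply: jet_class_eq.
    apply: (same_jet_of_chart fs ft ip) => a; apply/rowP => c.
    by have := e (enum_rank (a, c)); rewrite !mxE enum_rankK.
  have [s [fs es]] := exists_section (fun a => \row_c y 0 (enum_rank (a, c))) ip.
  pose C : jet_fiber E r p := exist _ (jet_class r p s) (ex_intro _ s (conj fs erefl)).
  exists C; rewrite /= (jet_trivE (s := s)) //; apply/rowP => l.
  by rewrite mxE es mxE -surjective_pairing enum_valK.
pose C a := projT1 (cid (xderiv_transition i j a)).
have CP a : (forall a', basic_smooth (chart_img i (cdom (F i) `&` cdom (F j))) (C a a')) /\
  forall p (s : forall p, fiber E p), foliated_near p s -> cdom (F i) p -> cdom (F j) p ->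
    xderiv j a s p = \sum_(a' : multi_index r) xderiv i a' s p *m C a a' (F i p).
  by rewrite /C; case: cid.
exists (fun z => \matrix_(l, l') C (enum_val l').1 (enum_val l).1 z
                                   (enum_val l).2 (enum_val l').2).
have oA : open (chart_img i (cdom (F i) `&` cdom (F j))) by exact: chart_img2_open.
split=> [|p D ip jp].
  apply/basic_smooth_mxP => // l l'; under eq_fun do rewrite mxE.
  by have /(basic_smooth_mxP _ oA) := (CP (enum_val l').1).1 (enum_val l).1; exact.
have [s [fs Ds]] := svalP D.
rewrite /= !(jet_trivE Ds) //; apply/rowP => l'.
rewrite !mxE (CP _).2 // summxE.
under [RHS]eq_bigr do rewrite !mxE.
rewrite -(big_enum_val (fun x : jet_index r => xderiv i x.1 s p 0 x.2 *
  C (enum_val l').1 x.1 (F i p) x.2 (enum_val l').2)) /=.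
rewrite -(pair_bigA _ (fun a c => xderiv i a s p 0 c *
  C (enum_val l').1 a (F i p) c (enum_val l').2)) /=.
by apply: eq_bigr => a _; rewrite mxE.
Qed.

End JetBundle.


(** * Positive definite forms *)

Section PositiveForms.
Context {R : realType}.

Definition spd n (A : 'M[R]_n) :=
  A^T = A /\ forall y : 'rV_n, y != 0 -> 0 < (y *m A *m y^T) 0 0.

Lemma spd_unit n (A : 'M[R]_n) : spd A -> A \in unitmx.
Proof.
move=> [_ pA]; rewrite unitmxE unitfE; apply/negP => /det0P [v v0 vA].
by have := pA v v0; rewrite vA mul0mx mxE ltxx.
Qed.

Lemma spd_ge0 n (A : 'M[R]_n) (y : 'rV_n) : spd A -> 0 <= (y *m A *m y^T) 0 0.
Proof.
move=> [_ pA]; have [->|y0] := eqVneq y 0; first by rewrite !mul0mx mxE.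
exact: ltW (pA y y0).
Qed.

Lemma spd_inv n (A : 'M[R]_n) : spd A -> spd (invmx A).
Proof.
move=> sA; have uA := spd_unit sA; have [tA pA] := sA.
have tI : (invmx A)^T = invmx A by rewrite trmx_inv tA.
split=> // y y0.
have -> : y *m invmx A *m y^T = (y *m invmx A) *m A *m (y *m invmx A)^T.
  by rewrite trmx_mul tI mulmxKV // !mulmxA.
apply: pA; apply: contraNneq y0 => e.
by rewrite -(mulmxKV uA y) e mul0mx.
Qed.

(** Split off one square and apply induction to the Schur complement, which is
    again positive definite. *)
Lemma spd_sum_squares n (A : 'M[R]_n) : spd A ->
  exists2 S : 'M[R]_n, S \in unitmx & A = S^T *m S.
Proof.
elim: n A => [|n IH] A sA.
  by exists 1%:M; rewrite ?unitmx1 //; apply/matrixP => -[].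
pose B : 'M[R]_(1 + n) := A; have sB : spd B by []; have [tB pB] := sB.
pose a := ulsubmx B 0 0; pose b := ursubmx B; pose C := drsubmx B.
have tC : C^T = C by rewrite /C trmx_drsub tB.
have eb : dlsubmx B = b^T by rewrite /b trmx_ursub tB.
have ea : ulsubmx B = a%:M by rewrite [LHS]mx11_scalar.
have eB : B = block_mx a%:M b b^T C by rewrite -ea -eb submxK.
have a0 : 0 < a.
  have := pB (row_mx 1%:M 0); rewrite eB mul_row_block mul1mx mul0mx addr0 mul1mx.
  rewrite mul0mx addr0 tr_row_mx mul_row_col trmx1 mulmx1 trmx0 mulmx0 addr0 mxE eqxx mulr1n.
  apply; rewrite row_mx_eq0 negb_and; apply/orP; left.
  by apply/negP => /eqP /matrixP /(_ 0 0); rewrite !mxE eqxx => /eqP; rewrite oner_eq0.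
have an0 : a != 0 by rewrite gt_eqF.
pose D : 'M[R]_n := C - a^-1 *: (b^T *m b).
have sD : spd D.
  split=> [|y y0]; first by rewrite /D linearB linearZ /= trmx_mul trmxK tC.
  (* The first coordinate that makes the split square vanish. *)
  pose x : 'M[R]_1 := - (a^-1 *: (y *m b^T)).
  have := pB (row_mx x y); rewrite eB mul_row_block tr_row_mx mul_row_col.
  have -> : x *m a%:M + y *m b^T = 0.
    by rewrite mul_mx_scalar /x scalerN scalerA mulfV // scale1r addNr.
  rewrite mul0mx add0r.
  have -> : x *m b + y *m C = y *m D.
    by rewrite /x /D mulNmx -scalemxAl mulmxBr -scalemxAr mulmxA addrC.
  by apply; rewrite row_mx_eq0 negb_and y0 orbT.
have [S uS eS] := IH D sD.
pose c := Num.sqrt a; have c0 : c != 0 by rewrite gt_eqF // sqrtr_gt0.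
have cc : c * c = a by rewrite -expr2 sqr_sqrtr // ltW.
pose Q : 'M[R]_(1 + n) := block_mx c%:M (c^-1 *: b) 0 S.
have uQ : Q \in unitmx.
  rewrite unitmxE /Q det_ublock det_scalar1 unitfE mulf_neq0 //.
  by move: uS; rewrite unitmxE unitfE.
suff eQ : B = Q^T *m Q by exists Q.
rewrite eB /Q tr_block_mx mulmx_block trmx0 !mul0mx !addr0 -eS.
rewrite tr_scalar_mx -scalar_mxM cc mul_scalar_mx scalerA mulfV // scale1r.
rewrite linearZ /= mul_mx_scalar scalerA mulfV // scale1r -scalemxAl -scalemxAr scalerA.
by rewrite -invfM cc /D mulmx0 addr0 addrCA subrr addr0.
Qed.

(** With [P = S^T *m S], the trace is the sum over the rows of [S *m A] of their
    squared norms for [G]. *)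
Lemma spd_trace_gt0 n (P G : 'M[R]_n) (A : 'M[R]_n) : spd P -> spd G -> A != 0 ->
  0 < \tr (P *m A *m G *m A^T).
Proof.
move=> sP sG A0; have [S uS ->] := spd_sum_squares sP.
have -> : S^T *m S *m A *m G *m A^T = S^T *m ((S *m A) *m G *m A^T) by rewrite !mulmxA.
rewrite mxtrace_mulC; set B := S *m A.
have -> : B *m G *m A^T *m S^T = B *m G *m B^T by rewrite [B^T]trmx_mul !mulmxA.
have B0 : B != 0.
  by apply: contraNneq A0 => e; rewrite -(mulKmx uS A) -/B e mulmx0.
have E l : (B *m G *m B^T) l l = (row l B *m G *m (row l B)^T) 0 0.
  rewrite -row_mul [LHS]mxE [RHS]mxE; apply: eq_bigr => c _.
  by congr (_ * _); [rewrite [RHS]mxE|rewrite !mxE].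
have [l Bl] : exists l, row l B != 0.
  apply/existsP; apply: contraNT B0 => /existsPn H; apply/eqP/row_matrixP => l.
  by have := H l; rewrite negbK row0 => /eqP.
rewrite /mxtrace (bigD1 l) //= ltr_wpDr //.
  by apply: sumr_ge0 => l' _; rewrite E; exact: spd_ge0.
by rewrite E; exact: sG.2.
Qed.

End PositiveForms.

(** * The Levi-Civita connection of a holonomy invariant metric *)

Section LeviCivita.
Context {R : realType} {n : nat}.
Implicit Types (D L : 'rV[R]_n -> 'M[R]_n).

(** Koszul's formula: for [D v] the derivative along [v] of the matrix of a
    metric, [koszul D v] is the matrix of the Levi-Civita form
    [u, w |-> g(nabla_v u, w)] on constant fields. *)
Definition koszul D v : 'M[R]_n :=
  \matrix_(a, b) (2^-1 * (D v a b + (v *m D (delta_mx 0 a)) 0 b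
                                  - (v *m D (delta_mx 0 b)) 0 a)).

Definition symmetric_family L := forall v w, v *m L w = w *m L v.

Section Koszul.
Context (D : 'rV[R]_n -> 'M[R]_n).
Context (Dl : forall c v w, D (c *: v + w) = c *: D v + D w).
Context (Ds : forall v, (D v)^T = D v).

Lemma koszul_linear c v w : koszul D (c *: v + w) = c *: koszul D v + koszul D w.
Proof.
have e x : (c *: v + w) *m D (delta_mx 0 x) =
    c *: (v *m D (delta_mx 0 x)) + w *m D (delta_mx 0 x).
  by rewrite mulmxDl -scalemxAl.
have eE (x y z : 'rV[R]_n) b : x = c *: y + z -> x 0 b = c * y 0 b + z 0 b.
  by move=> ->; rewrite !mxE.
apply/matrixP => a b; rewrite [RHS]mxE [in X in _ = X + _]mxE ![koszul D _ a b]mxE.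
by rewrite (eE _ _ _ _ (e a)) (eE _ _ _ _ (e b)) Dl 2!mxE; ring.
Qed.

Lemma family_sumE v : D v = \sum_a v 0 a *: D (delta_mx 0 a).
Proof.
have D0 : D 0 = 0 by have := Dl (-1) 0 0; rewrite scaleN1r oppr0 addr0 scaleN1r addNr.
rewrite {1}(row_sum_delta v); elim: (index_enum _) => [|a s IH].
  by rewrite !big_nil.
by rewrite !big_cons Dl IH.
Qed.

Lemma Ds_entry v a b : D v a b = D v b a.
Proof. by rewrite -[in LHS]Ds mxE. Qed.

Lemma koszul_delta a b c : koszul D (delta_mx 0 a) b c =
  2^-1 * (D (delta_mx 0 a) b c + D (delta_mx 0 b) a c - D (delta_mx 0 c) a b).
Proof. by rewrite mxE -!rowE !mxE. Qed.

Lemma koszul_symmetric : symmetric_family (koszul D).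
Proof.
have Ks v : koszul D v = \sum_a v 0 a *: koszul D (delta_mx 0 a).
  have K0 : koszul D 0 = 0.
    by have := koszul_linear (-1) 0 0; rewrite scaleN1r oppr0 addr0 scaleN1r addNr.
  rewrite {1}(row_sum_delta v); elim: (index_enum _) => [|a s IH].
    by rewrite !big_nil.
  by rewrite !big_cons koszul_linear IH.
move=> v w; rewrite (Ks v) (Ks w) !mulmx_sumr; apply/rowP => c.
rewrite !summxE.
have E u a : (u *m (w 0 a *: koszul D (delta_mx 0 a))) 0 c =
    \sum_b u 0 b * (w 0 a * koszul D (delta_mx 0 a) b c).
  by rewrite mxE; apply: eq_bigr => b _; rewrite mxE.
under eq_bigr do rewrite E.
have E' a : (w *m (v 0 a *: koszul D (delta_mx 0 a))) 0 c =
    \sum_b w 0 b * (v 0 a * koszul D (delta_mx 0 a) b c).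
  by rewrite mxE; apply: eq_bigr => b _; rewrite mxE.
under [RHS]eq_bigr do rewrite E'.
rewrite exchange_big /=; apply: eq_bigr => a _; apply: eq_bigr => b _.
by rewrite !koszul_delta (Ds_entry (delta_mx 0 c) a b); ring.
Qed.

Lemma koszul_metric v : koszul D v + (koszul D v)^T = D v.
Proof.
apply/matrixP => a b; rewrite !mxE (Ds_entry v b a).
by field.
Qed.

End Koszul.

(** As a function of three vectors, the difference is symmetric in the first two
    and antisymmetric in the last two, and such a function vanishes. This is the
    uniqueness of the Levi-Civita connection. *)
Lemma symmetric_family_unique L L' : symmetric_family L -> symmetric_family L' ->
  (forall v, L v + (L v)^T = L' v + (L' v)^T) -> forall v, L v = L' v.
Proof.
move=> sL sL' e v; pose t (u v w : 'rV[R]_n) := ((u *m (L v - L' v)) *m w^T) 0 0.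
have t1 u x w : t u x w = t x u w by rewrite /t !mulmxBr sL sL'.
have t2 u x w : t u x w = - t w x u.
  have E : L x - L' x = - (L x - L' x)^T.
    apply/eqP; rewrite linearB /= opprB subr_eq addrAC eq_sym subr_eq.
    by rewrite [X in X == _]addrC e.
  rewrite /t {1}E mulmxN mulNmx mxE; congr (- _).
  have -> : u *m (L x - L' x)^T *m w^T = (w *m (L x - L' x) *m u^T)^T.
    by rewrite !trmx_mul trmxK mulmxA.
  by rewrite mxE.
have t0 u x w : t u x w = 0.
  (* Alternating the two symmetries six times gives back [t u x w] negated. *)
  have : t u x w = - t u x w.
    by rewrite {1}(t2 u x w) (t1 w x u) (t2 x w u) opprK (t1 u w x) (t2 w u x) (t1 x u w).
  by move/eqP; rewrite -addr_eq0 -mulr2n mulrn_eq0 /= => /eqP.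
apply/eqP; rewrite -subr_eq0; apply/eqP; apply: form_eq => y z.
by rewrite mulmx0 mul0mx [RHS]mxE; exact: t0.
Qed.

End LeviCivita.

Section Christoffel.
Context {R : realType} {M : topologicalType} {k q : nat} {F : fatlas R M k q}.
Context (hF : foliated_atlas F).

Definition djac (i j : aidx F) (z : 'rV[R]_(k + q)) (v : 'rV[R]_q) : 'M[R]_q :=
  'D_(row_mx 0 v) (tjac_transition i j) z.

(** The Jacobian consists of first derivatives of the transition map, so this
    is the symmetry of its second derivatives. *)
Lemma djac_symmetric i j p : cdom (F i) p -> cdom (F j) p ->
  symmetric_family (djac i j (F i p)).
Proof.
move=> ip jp v w; set z := F i p.
have oA : open (chart_img i (cdom (F i) `&` cdom (F j))) by exact: chart_img2_open.
have Az : chart_img i (cdom (F i) `&` cdom (F j)) z by exists p.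
have ft := transition_foliated hF i j.
have dJ := smooth_on_diff (tjac_transition_basic hF i j).1 Az.
have E (x y : 'rV[R]_q) :
    x *m djac i j z y = rsubmx ('D_(row_mx 0 y) ('D_(row_mx 0 x) (transition i j)) z).
  have E1 Y : chart_img i (cdom (F i) `&` cdom (F j)) Y ->
      rsubmx ('D_(row_mx 0 x) (transition i j) Y) = x *m tjac_transition i j Y.
    by move=> AY; rewrite (tjacE _ ft AY) row_mxKr.
  have dD : differentiable ('D_(row_mx 0 x) (transition i j)) z.
    exact: smooth_on_diff (smooth_on_derive _ ft.1) Az.
  apply: etrans (esym (derive_linear_comp (mulmx x) _ dJ)) _.
  apply: etrans (derive_linear_comp rsubmx _ dD).
  by apply: (derive_ext _ oA _ Az) => Y AY; exact: esym (E1 Y AY).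
apply: etrans (E v w) _; apply: etrans (esym (E w v)).
apply: (congr1 rsubmx).
exact: (derive_comm_mx (row_mx 0 w) (row_mx 0 v) oA ft.1 Az).
Qed.

Context {H : aidx F -> 'rV[R]_(k + q) -> 'M[R]_q} (hH : coord_metric H).

Let bH i : basic_smooth (chart_img i (cdom (F i))) (H i). Proof. by case: hH. Qed.

Lemma metric_spd i p : cdom (F i) p -> spd (H i (F i p)).
Proof. by case: hH => _ pH _ ip; exact: pH. Qed.

Lemma metric_transition i j p : cdom (F i) p -> cdom (F j) p ->
  H i (F i p) = tjac_transition i j (F i p) *m H j (F j p) *m (tjac_transition i j (F i p))^T.
Proof. by case: hH => _ _; exact. Qed.

Lemma chart_img1_open i : open (chart_img i (cdom (F i))).
Proof. by apply: chart_img_open => //; exact: cdom_open. Qed.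

Definition dmetric i z (v : 'rV[R]_q) : 'M[R]_q := 'D_(row_mx 0 v) (H i) z.

Definition christoffel i z (v : 'rV[R]_q) : 'M[R]_q :=
  koszul (dmetric i z) v *m invmx (H i z).

Lemma derive_x_linear (W : normedModType R) (f : 'rV[R]_(k + q) -> W) z c (v w : 'rV[R]_q) :
  differentiable f z ->
  'D_(row_mx 0 (c *: v + w)) f z = c *: 'D_(row_mx 0 v) f z + 'D_(row_mx 0 w) f z.
Proof.
move=> df; rewrite !deriveE //.
have -> : row_mx 0 (c *: v + w) = c *: row_mx 0 v + row_mx 0 w :> 'rV[R]_(k + q).
  by rewrite scale_row_mx add_row_mx scaler0 addr0.
by rewrite linearD linearZ.
Qed.

Section At.
Context (i : aidx F) (p : M) (ip : cdom (F i) p).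

Let Az : chart_img i (cdom (F i)) (F i p). Proof. by exists p. Qed.

Lemma dmetric_linear c v w :
  dmetric i (F i p) (c *: v + w) = c *: dmetric i (F i p) v + dmetric i (F i p) w.
Proof. by apply: derive_x_linear; exact: smooth_on_diff (bH i).1 Az. Qed.

Lemma dmetric_sym v : (dmetric i (F i p) v)^T = dmetric i (F i p) v.
Proof.
have dH := smooth_on_diff (bH i).1 Az.
apply: etrans (esym (derive_linear_comp trmx _ dH)) _.
apply: (derive_ext _ (@chart_img1_open i) _ Az) => _ [p' ip' <-].
by case: (metric_spd ip').
Qed.

Lemma christoffelK v :
  christoffel i (F i p) v *m H i (F i p) = koszul (dmetric i (F i p)) v.
Proof. by rewrite /christoffel mulmxKV //; apply: spd_unit; exact: metric_spd. Qed.

Lemma christoffel_linear c v w : christoffel i (F i p) (c *: v + w) =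
  c *: christoffel i (F i p) v + christoffel i (F i p) w.
Proof.
by rewrite /christoffel (koszul_linear dmetric_linear) mulmxDl scalemxAl.
Qed.

End At.

Lemma christoffel_basic i v :
  basic_smooth (chart_img i (cdom (F i))) (fun z => christoffel i z v).
Proof.
have oA := @chart_img1_open i.
apply: basic_smooth_mulmx => //; last first.
  apply: basic_smooth_invmx => // _ [p ip <-].
  by apply: spd_unit; exact: metric_spd.
have bD x : basic_smooth (chart_img i (cdom (F i))) (fun z => dmetric i z x).
  exact: basic_smooth_derive (bH i).
have bE x a b : basic_smooth (chart_img i (cdom (F i))) (fun z => dmetric i z x a b).
  by have /(basic_smooth_mxP _ oA) := bD x; exact.
have bV (y x : 'rV[R]_q) b : basic_smooth (chart_img i (cdom (F i)))
    (fun z => (y *m dmetric i z x) 0 b).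
  under eq_fun do rewrite mxE; apply: basic_smooth_sum => // c.
  by apply: basic_smoothM => //; exact: basic_smooth_cst.
apply/basic_smooth_mxP => // a b; under eq_fun do rewrite mxE.
apply: basic_smoothM => //; first exact: basic_smooth_cst.
apply: basic_smoothD => //; first exact: basic_smoothD.
under eq_fun do rewrite -mulN1r; apply: basic_smoothM => //.
exact: basic_smooth_cst.
Qed.

(** The Levi-Civita connection is invariant under the holonomy: the connection
    transported from the other chart is symmetric and metric. *)
Lemma christoffel_transition i j p v : cdom (F i) p -> cdom (F j) p ->
  let J := tjac_transition i j (F i p) in
  christoffel i (F i p) v *m J =
  J *m christoffel j (F j p) (v *m J) + djac i j (F i p) v.
Proof.
move=> ip jp J; set Gi := H i (F i p); set Gj := H j (F j p).
have uJ : J \in unitmx by exact: (tjac_transition_unit hF ip jp).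
have uGj : Gj \in unitmx by apply: spd_unit; exact: metric_spd.
have uGi : Gi \in unitmx by apply: spd_unit; exact: metric_spd.
have eG : Gi = J *m Gj *m J^T by exact: metric_transition.
pose Ki := koszul (dmetric i (F i p)); pose Kj := koszul (dmetric j (F j p)).
have cj x : christoffel j (F j p) x *m Gj = Kj x by exact: christoffelK.
have ci x : christoffel i (F i p) x *m Gi = Ki x by exact: christoffelK.
(* The lowered Levi-Civita form of the chart [j], transported to the chart [i]. *)
pose L x := (J *m Kj (x *m J) + djac i j (F i p) x *m Gj) *m J^T.
have dG x : dmetric i (F i p) x = djac i j (F i p) x *m Gj *m J^T +
    J *m dmetric j (F j p) (x *m J) *m J^T + J *m Gj *m (djac i j (F i p) x)^T.
  pose A := chart_img i (cdom (F i) `&` cdom (F j)).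
  have oA : open A by exact: chart_img2_open.
  have Az : A (F i p) by exists p.
  have ft := transition_foliated hF i j.
  have AB y : A y -> chart_img j (cdom (F j)) (transition i j y).
    by move=> [p' [ip' jp'] <-]; rewrite transitionE //; exists p'.
  have bHt : basic_smooth A (fun y => H j (transition i j y)).
    exact: (basic_smooth_comp oA (@chart_img1_open j) AB (bH j) ft).
  have bJ := tjac_transition_basic hF i j.
  have bJt : basic_smooth A (fun y => (tjac_transition i j y)^T).
    exact: (@basic_smooth_linear _ _ _ _ _ _ _ trmx _ _ oA bJ).
  have bJH : basic_smooth A (fun y => tjac_transition i j y *m H j (transition i j y)).
    exact: basic_smooth_mulmx.
  have dJ := smooth_on_diff bJ.1 Az; have dJt := smooth_on_diff bJt.1 Az.
  have dHt := smooth_on_diff bHt.1 Az; have dJH := smooth_on_diff bJH.1 Az.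
  have e y : A y -> H i y =
      tjac_transition i j y *m H j (transition i j y) *m (tjac_transition i j y)^T.
    move=> [p' [ip' jp'] <-]; rewrite (transitionE hF j ip').
    exact: (metric_transition ip' jp').
  apply: etrans (derive_ext _ oA e Az) _.
  apply: etrans (derive_mulmx _ dJH dJt) _.
  rewrite (derive_mulmx _ dJ dHt) (derive_linear_comp trmx _ dJ).
  rewrite (derive_basic_comp _ AB (bH j) ft Az) row_mxKr transitionE // mulmxDl.
  by [].
have sL : symmetric_family L.
  move=> x y.
  have s1 : x *m J *m Kj (y *m J) = y *m J *m Kj (x *m J).
    exact: (koszul_symmetric (dmetric_linear jp) (dmetric_sym jp)).
  have s2 : x *m djac i j (F i p) y = y *m djac i j (F i p) x.
    exact: (djac_symmetric ip jp).
  by rewrite /L 2!mulmxA !mulmxDr !mulmxA s1 s2.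
have sK : symmetric_family Ki.
  exact: koszul_symmetric (dmetric_linear ip) (dmetric_sym ip).
have sGj : Gj^T = Gj by case: (metric_spd jp).
have KL : forall x, Ki x = L x.
  apply: symmetric_family_unique => // x.
  rewrite (koszul_metric (dmetric_sym ip)) dG -(koszul_metric (dmetric_sym jp) (x *m J)) -/Kj.
  rewrite /L !mulmxDl !linearD /= !trmx_mul !trmxK sGj ?mulmxDr ?mulmxDl ?mulmxA.
  set a1 := djac _ _ _ _ *m _ *m _; set a2 := J *m Kj _ *m _.
  set a3 := J *m _ *m _; set a4 := J *m _ *m _.
  by rewrite addrA (addrC a1) !addrA; congr (_ + _); rewrite addrAC.
apply: (can_inj (mulmxK (n := q) (_ : Gj *m J^T \in unitmx))).
  by rewrite unitmx_mul uGj unitmx_tr.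
have E1 : christoffel i (F i p) v *m J *m (Gj *m J^T) = L v.
  by rewrite -KL -ci eG !mulmxA.
by rewrite E1 /L -cj !mulmxDl !mulmxA.
Qed.

End Christoffel.

(** * A Sasaki metric on the bundle of 1-jets *)

Section SasakiForm.
Context {R : realType} {q : nat}.
Implicit Types (G J A : 'M[R]_q) (x d : 'rV[R]_q).

(** The scalar product of triples made of two vectors and an endomorphism. The
    trace is the scalar product induced by [G] on endomorphisms, seen as forms
    with values in vectors. *)
Definition sform G x1 d1 A1 x2 d2 A2 : R :=
  (x1 *m G *m x2^T) 0 0 + (d1 *m G *m d2^T) 0 0 + \tr (invmx G *m A1 *m G *m A2^T).

Lemma sform_sym G x1 d1 A1 x2 d2 A2 : G^T = G ->
  sform G x1 d1 A1 x2 d2 A2 = sform G x2 d2 A2 x1 d1 A1.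
Proof.
move=> sG; have sI : (invmx G)^T = invmx G by rewrite trmx_inv sG.
have E (u v : 'rV[R]_q) : (u *m G *m v^T) 0 0 = (v *m G *m u^T) 0 0.
  by rewrite -[in LHS](trmxK (u *m G *m v^T)) mxE !trmx_mul trmxK sG mulmxA.
rewrite /sform (E x1) (E d1); congr (_ + _).
rewrite -[LHS]mxtrace_tr !trmx_mul trmxK sI sG mxtrace_mulC mulmxA.
by rewrite -!mulmxA mulmxA mxtrace_mulC !mulmxA mxtrace_mulC !mulmxA.
Qed.

Lemma sform_linear G c x d A x' d' A' x2 d2 A2 :
  sform G (c *: x + x') (c *: d + d') (c *: A + A') x2 d2 A2 =
  c * sform G x d A x2 d2 A2 + sform G x' d' A' x2 d2 A2.
Proof.
rewrite /sform mulmxDr !mulmxDl linearD /= -!scalemxAr -!scalemxAl linearZ /=.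
have E (u v : 'M[R]_1) : (c *: u + v) 0 0 = c * u 0 0 + v 0 0 by rewrite !mxE.
by rewrite !E; ring.
Qed.

Lemma sform_gt0 G x d A : spd G -> (x != 0) || (d != 0) || (A != 0) ->
  0 < sform G x d A x d A.
Proof.
move=> sG; have [_ pG] := sG; have sI := spd_inv sG.
have tr0 : 0 <= \tr (invmx G *m A *m G *m A^T).
  have [->|A0] := eqVneq A 0; first by rewrite mulmx0 !mul0mx mxtrace0.
  exact: ltW (spd_trace_gt0 sI sG A0).
have x0 := spd_ge0 x sG; have d0 := spd_ge0 d sG.
rewrite /sform => /orP [/orP [xn|dn]|An].
- by have := pG x xn => h; rewrite ltr_wpDr // ltr_wpDr.
- by have := pG d dn => h; rewrite ltr_wpDr // ltr_wpDl.
- by rewrite ltr_wpDl ?addr_ge0 //; exact: spd_trace_gt0.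
Qed.

Lemma sform_change_frame G G' J x1 d1 A1 x2 d2 A2 B1 B2 : G' \in unitmx -> J \in unitmx ->
  G = J *m G' *m J^T -> J *m B1 = A1 *m J -> J *m B2 = A2 *m J ->
  sform G x1 d1 A1 x2 d2 A2 = sform G' (x1 *m J) (d1 *m J) B1 (x2 *m J) (d2 *m J) B2.
Proof.
move=> uG uJ eG e1 e2.
have uT : J^T \in unitmx by rewrite unitmx_tr.
have eI : invmx G = invmx J^T *m invmx G' *m invmx J.
  have uGJ : G \in unitmx by rewrite eG !unitmx_mul uJ uG.
  apply: (can_inj (mulKmx uGJ)); rewrite mulmxV // eG !mulmxA.
  by rewrite mulmxK // mulmxK // mulmxV.
have e1' : A1 *m G = J *m B1 *m G' *m J^T by rewrite eG !mulmxA -e1.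
have e2' : J^T *m A2^T = B2^T *m J^T by rewrite -!trmx_mul e2.
have eM : invmx G *m A1 *m G *m A2^T =
    invmx J^T *m (invmx G' *m B1 *m G' *m B2^T) *m J^T.
  by rewrite eI -(mulmxA _ A1) e1' -!mulmxA (mulKmx uJ) e2'.
rewrite /sform eM mxtrace_mulC mulKVmx //.
by congr (_ + _); rewrite eG !trmx_mul !mulmxA.
Qed.

End SasakiForm.

Section FormMatrix.
Context {R : realType} {n q : nat}.
Context (Lx Ld : 'rV[R]_n -> 'rV[R]_q) (La : 'rV[R]_n -> 'M[R]_q).
Context (lx : forall c a b, Lx (c *: a + b) = c *: Lx a + Lx b).
Context (ld : forall c a b, Ld (c *: a + b) = c *: Ld a + Ld b).
Context (la : forall c a b, La (c *: a + b) = c *: La a + La b).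
Context (G : 'M[R]_q) (sG : spd G).

Definition pform a b := sform G (Lx a) (Ld a) (La a) (Lx b) (Ld b) (La b).

Definition pform_mx : 'M[R]_n := \matrix_(i, j) pform (delta_mx 0 i) (delta_mx 0 j).

Let pl c a b b' : pform (c *: a + b) b' = c * pform a b' + pform b b'.
Proof. by rewrite /pform lx ld la sform_linear. Qed.

Lemma pform_sym a b : pform a b = pform b a.
Proof. by apply: sform_sym; case: sG. Qed.

Let suml a b : pform a b = \sum_i a 0 i * pform (delta_mx 0 i) b.
Proof.
have p0 : pform 0 b = 0.
  by have := pl (-1) 0 0 b; rewrite scaler0 addr0 mulN1r addNr.
rewrite {1}(row_sum_delta a); elim: (index_enum _) => [|i s IH].
  by rewrite !big_nil.
by rewrite !big_cons pl IH.
Qed.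

Lemma pform_mxE a b : (a *m pform_mx *m b^T) 0 0 = pform a b.
Proof.
rewrite mxE [RHS]pform_sym [RHS]suml; apply: eq_bigr => j _.
rewrite [b^T _ _]mxE mulrC pform_sym suml mxE; congr (_ * _).
by apply: eq_bigr => i _; rewrite mxE.
Qed.

Lemma pform_spd : (forall a, Lx a = 0 -> Ld a = 0 -> La a = 0 -> a = 0) ->
  spd pform_mx.
Proof.
move=> inj; split=> [|a a0]; first by apply/matrixP => i j; rewrite !mxE pform_sym.
rewrite pform_mxE; apply: sform_gt0 => //.
apply: contraNT a0; rewrite !negb_or !negbK => /andP [/andP [/eqP ? /eqP ?] /eqP ?].
by apply/eqP; exact: inj.
Qed.

End FormMatrix.

Section JetCoordinates.
Context {R : realType} {q m : nat}.

Lemma exists_mword0 : exists a : multi_index (q := q) 1, mword a = [::].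
Proof.
have [a] := exists_mword (r := 1) (w := [::] : seq 'I_q) isT.
by rewrite perm_sym => /perm_nilP e; exists a.
Qed.

Lemma exists_mword1 (b : 'I_q) : exists a : multi_index (q := q) 1, mword a = [:: b].
Proof.
have [a] := exists_mword (r := 1) (w := [:: b]) isT.
by rewrite perm_sym => /perm_small_eq e; exists a; apply: e.
Qed.

Definition jet_value (y : 'rV[R]_#|{: jet_index (q := q) (m := m) 1}|) : 'rV[R]_m :=
  \row_c y 0 (enum_rank ((projT1 (cid exists_mword0), c) : jet_index 1)).

Definition jet_slope (y : 'rV[R]_#|{: jet_index (q := q) (m := m) 1}|) : 'M[R]_(q, m) :=
  \matrix_(b, c) y 0 (enum_rank ((projT1 (cid (exists_mword1 b)), c) : jet_index 1)).

Lemma jet_value_is_linear : linear jet_value.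
Proof. by move=> c x y; apply/matrixP => i j; rewrite !mxE. Qed.
HB.instance Definition _ := GRing.isLinear.Build R _ _ _ jet_value jet_value_is_linear.

Lemma jet_slope_is_linear : linear jet_slope.
Proof. by move=> c x y; apply/matrixP => i j; rewrite !mxE. Qed.
HB.instance Definition _ := GRing.isLinear.Build R _ _ _ jet_slope jet_slope_is_linear.

Lemma mword_inj r (a a' : multi_index (q := q) r) : mword a = mword a' -> a = a'.
Proof.
move=> e; apply: eq_sval; apply/ffunP => b; apply: val_inj => /=.
by rewrite -!count_mword e.
Qed.

Lemma jet_value_slope_inj y : jet_value y = 0 -> jet_slope y = 0 -> y = 0.
Proof.
move=> /rowP v0 /matrixP s0; apply/rowP => l; rewrite mxE.
rewrite -(enum_valK l); case: (enum_val l) => a c.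
have := size_mword a; case e: (mword a) => [|b [|//]] _.
  have := v0 c; rewrite !mxE; case: cid => a' /= e'.
  by rewrite (mword_inj (etrans e (esym e'))).
have := s0 b c; rewrite !mxE; case: cid => a' /= e'.
by rewrite (mword_inj (etrans e (esym e'))).
Qed.

End JetCoordinates.

Section JetOfVectorFields.
Context {R : realType} {M : topologicalType} {k q : nat} {F : fatlas R M k q}.
Context (hF : foliated_atlas F).

Let N := normal_bundle F.

Lemma jet_valueE i p (D : fiber (jet_bundle N 1) p) s : sval D = jet_class 1 p s ->
  cdom (F i) p -> jet_value (triv i D) = read (F i) (component i s) (F i p).
Proof.
move=> Ds ip; rewrite /= (jet_trivE Ds ip); apply/rowP => c.
rewrite [LHS]mxE [LHS]mxE enum_rankK /=; case: cid => a /= e.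
by rewrite /xderiv partial_xE e.
Qed.

Lemma jet_slopeE i p (D : fiber (jet_bundle N 1) p) s : sval D = jet_class 1 p s ->
  cdom (F i) p ->
  jet_slope (triv i D) = \matrix_(b, c) ('D_(xdir b) (read (F i) (component i s)) (F i p)) 0 c.
Proof.
move=> Ds ip; rewrite /= (jet_trivE Ds ip); apply/matrixP => b c.
rewrite [LHS]mxE [LHS]mxE enum_rankK /= [RHS]mxE; case: cid => a /= e.
by rewrite /xderiv partial_xE e.
Qed.

Lemma derive_x_rows (f : 'rV[R]_(k + q) -> 'rV[R]_q) z (v : 'rV[R]_q) :
  differentiable f z ->
  'D_(row_mx 0 v) f z = v *m \matrix_(b, c) ('D_(xdir b) f z) 0 c.
Proof.
move=> df; rewrite derive_xE //; apply/rowP => c; rewrite summxE mxE.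
by apply: eq_bigr => b _; rewrite !mxE.
Qed.

(** The second rule is the derivative of the first, which holds for the values
    of a section representing the jet; the symmetry of second derivatives allows
    to exchange the direction and the value in the last term. *)
Lemma jet_transition i j p (D : fiber (jet_bundle N 1) p) : cdom (F i) p -> cdom (F j) p ->
  let J := tjac_transition i j (F i p) in
  jet_value (triv j D) = jet_value (triv i D) *m J /\
  J *m jet_slope (triv j D) =
    jet_slope (triv i D) *m J + djac i j (F i p) (jet_value (triv i D)).
Proof.
move=> ip jp J; have [s [[V [oV Vp sV]] Ds]] := svalP D.
pose U := V `&` (cdom (F i) `&` cdom (F j)).
have oU : open U by apply: openI => //; exact: dom2_open.
have sU : foliated_section U s by apply: foliated_sectionS sV => // y [].
pose f := read (F i) (component i s); pose g := read (F j) (component j s).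
have bf : basic_smooth (chart_img i U) f.
  by apply: component_basic => // y [_ []].
have bg : basic_smooth (chart_img j U) g.
  by apply: component_basic => // y [_ []].
have fg y : chart_img i U y -> g (transition i j y) = f y *m tjac_transition i j y.
  move=> [p' [_ [ip' jp']] <-]; rewrite transitionE // /f /g !readF //.
  exact: normal_triv_tjac.
have Up : U p by [].
have oA : open (chart_img i U) by apply: chart_img_open => // y [_ []].
have Az : chart_img i U (F i p) by exists p.
have AA : chart_img i U `<=` chart_img i (cdom (F i) `&` cdom (F j)).
  by move=> _ [y [_ Uy] <-]; exists y.
have AB y : chart_img i U y -> chart_img j U (transition i j y).
  by move=> [p' /[dup] Up' [_ [ip' jp']] <-]; rewrite transitionE //; exists p'.
have ft := foliated_mapS AA (transition_foliated hF i j).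
have df := smooth_on_diff bf.1 Az.
have dJ := smooth_on_diff (tjac_transition_basic hF i j).1 (AA _ Az).
have Bz : chart_img j U (F j p) by exists p.
have dg := smooth_on_diff bg.1 Bz.
rewrite !(jet_valueE Ds) // !(jet_slopeE Ds) // -/f -/g.
split; first by rewrite -fg // transitionE.
set Sj := \matrix_(b, c) _; set Si := \matrix_(b, c) _.
apply/row_matrixP => b; rewrite !rowE; move: (delta_mx 0 b) => x.
have Ei : x *m Si = 'D_(row_mx 0 x) f (F i p).
  exact: esym (derive_x_rows x df).
have Ej : x *m J *m Sj = 'D_(row_mx 0 (x *m J)) g (F j p).
  exact: esym (derive_x_rows _ dg).
have ES : x *m djac i j (F i p) (f (F i p)) = f (F i p) *m djac i j (F i p) x.
  exact: (djac_symmetric hF ip jp).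
have key : 'D_(row_mx 0 x) (fun y => g (transition i j y)) (F i p) =
    'D_(row_mx 0 (x *m J)) g (F j p).
  apply: etrans (derive_basic_comp (row_mx 0 x) AB bg ft Az) _.
  by rewrite (row_mxKr (0 : 'rV[R]_k) x) (transitionE hF j ip).
rewrite mulmxA Ej mulmxDr mulmxA Ei ES; apply: etrans (esym key) _.
apply: etrans (derive_ext _ oA fg Az) _; exact: (derive_mulmx _ df dJ).
Qed.

End JetOfVectorFields.

(** If [C] is conjugated by [J] and the connection changes by the derivative
    [dd] of [J], then the covariant derivative of [C] is conjugated by [J]. *)
Lemma conjugate_derivation (R : comNzRingType) n (J di dj Ci Cj gi gj dd : 'M[R]_n) :
  dd *m Cj + J *m dj = di *m J + Ci *m dd -> J *m Cj = Ci *m J ->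
  gi *m J = J *m gj + dd ->
  J *m (dj + (Cj *m gj - gj *m Cj)) = (di + (Ci *m gi - gi *m Ci)) *m J.
Proof.
move=> E1 E2 E3.
have E4 : J *m dj = di *m J + Ci *m dd - dd *m Cj by rewrite -E1 addrAC subrr add0r.
have E5 : J *m gj = gi *m J - dd by rewrite E3 addrK.
have E6 : J *m Cj *m gj = Ci *m gi *m J - Ci *m dd.
  by rewrite E2 -mulmxA E5 mulmxBr mulmxA.
have E7 : J *m gj *m Cj = gi *m Ci *m J - dd *m Cj.
  by rewrite E5 mulmxBl -(mulmxA gi J) E2 mulmxA.
rewrite mulmxDr mulmxBr mulmxDl mulmxBl !mulmxA E4 E6 E7.
move: (di *m J) (Ci *m dd) (dd *m Cj) (Ci *m gi *m J) (gi *m Ci *m J) => x1 x2 x3 x4 x5.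
by apply/matrixP => r c; rewrite !mxE; ring.
Qed.

Section SasakiMetric.
Context {R : realType} {M : topologicalType} {k q : nat} {F : fatlas R M k q}.
Context (hF : foliated_atlas F).
Context {H : aidx F -> 'rV[R]_(k + q) -> 'M[R]_q} (hH : coord_metric H).

Let E := jet_bundle (normal_bundle F) 1.
Let m := #|{: jet_index (q := q) (m := q) 1}|.
Let F' : fatlas R (total_space E) k (q + m) := lifted_foliation E.
Let hE : foliated_bundle E := jet_bundle_foliated hF (normal_bundle_foliated hF) 1.
Let hF' : foliated_atlas F' := lifted_foliated_atlas hF hE.

Implicit Types (i j : aidx F) (w : total_space E) (Z : 'rV[R]_(k + (q + m))).
Implicit Types (a b : 'rV[R]_(q + m)).

Definition value_at Z : 'rV[R]_q := jet_value (fiber_proj Z).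
Definition slope_at Z : 'M[R]_q := jet_slope (fiber_proj Z).

(** The matrix of the covariant derivative [w |-> nabla_w X] of a vector field
    [X] with the given 1-jet; the sum over [c] is the Christoffel form in the
    direction of the value of [X]. *)
Definition covariant_slope i Z : 'M[R]_q :=
  slope_at Z + \sum_c value_at Z 0 c *: christoffel (H := H) i (base_proj Z) (delta_mx 0 c).

(** [value_form] and [slope_form] are the covariant differentials, along a tangent
    vector [a] of the jet space, of the value and of the covariant slope. *)
Definition value_form i Z a : 'rV[R]_q :=
  jet_value (rsubmx a) + value_at Z *m christoffel (H := H) i (base_proj Z) (lsubmx a).

Definition slope_form i Z a : 'M[R]_q :=
  'D_(row_mx 0 a) (covariant_slope i) Z +
  (covariant_slope i Z *m christoffel (H := H) i (base_proj Z) (lsubmx a) -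
   christoffel (H := H) i (base_proj Z) (lsubmx a) *m covariant_slope i Z).

Definition sasaki i Z : 'M[R]_(q + m) :=
  pform_mx (@lsubmx R 1 q m) (value_form i Z) (slope_form i Z) (H i (base_proj Z)).

Let B i : set 'rV[R]_(k + (q + m)) := chart_img (F := F') i (cdom (F' i)).

Lemma domain_open i : open (B i).
Proof. by apply: (chart_img_open hF') => //; exact: (cdom_open hF'). Qed.

Lemma base_proj_domain i Z : B i Z -> chart_img i (cdom (F i)) (base_proj Z).
Proof. by move=> [w iw <-]; rewrite lifted_chartE base_proj_coord; exists (projT1 w). Qed.

Lemma base_proj_chart i w : base_proj (F' i w) = F i (projT1 w).
Proof. by rewrite lifted_chartE base_proj_coord. Qed.

Lemma basic_on_domain r c i (f : 'rV[R]_(k + q) -> 'M[R]_(r, c)) :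
  basic_smooth (chart_img i (cdom (F i))) f -> basic_smooth (B i) (fun Z => f (base_proj Z)).
Proof.
move=> bf; have oI : open (chart_img i (cdom (F i))) by exact: chart_img1_open.
have fb : foliated_map (B i) (@base_proj R k q m) by exact: base_proj_foliated.
exact: (basic_smooth_comp (@domain_open i) oI (@base_proj_domain i) bf fb).
Qed.

Lemma value_at_basic A : open A -> basic_smooth A value_at.
Proof.
move=> oA; exact: (@basic_smooth_linear _ _ _ _ _ _ _ jet_value _ _ oA (fiber_proj_basic A)).
Qed.

Lemma slope_at_basic A : open A -> basic_smooth A slope_at.
Proof.
move=> oA; exact: (@basic_smooth_linear _ _ _ _ _ _ _ jet_slope _ _ oA (fiber_proj_basic A)).
Qed.

Lemma covariant_slope_basic i : basic_smooth (B i) (covariant_slope i).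
Proof.
have oB := @domain_open i.
apply: basic_smoothD => //; first exact: slope_at_basic.
apply: basic_smooth_sum => // c.
have /(basic_smooth_mxP _ oB) bv := value_at_basic oB.
have /(basic_smooth_mxP _ oB) bc := basic_on_domain (christoffel_basic hF hH i (delta_mx 0 c)).
apply/basic_smooth_mxP => // r r'; under eq_fun do rewrite mxE.
exact: basic_smoothM.
Qed.

(** By linearity in the direction, the coordinates of the value recombine. *)
Lemma covariant_slopeE i w : cdom (F' i) w ->
  covariant_slope i (F' i w) = jet_slope (triv i (projT2 w)) +
    christoffel (H := H) i (F i (projT1 w)) (jet_value (triv i (projT2 w))).
Proof.
move=> iw; rewrite /covariant_slope base_proj_chart /slope_at /value_at.
rewrite lifted_chartE fiber_proj_coord.
by rewrite [in RHS](family_sumE (christoffel_linear hH iw)).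
Qed.

Lemma value_form_linear i w c a b : cdom (F' i) w ->
  value_form i (F' i w) (c *: a + b) = c *: value_form i (F' i w) a + value_form i (F' i w) b.
Proof.
move=> iw; rewrite /value_form !linearP /= base_proj_chart (christoffel_linear hH iw).
rewrite mulmxDr -scalemxAr scalerDr !addrA; congr (_ + _).
by rewrite -!addrA; congr (_ + _); rewrite addrC.
Qed.

Lemma slope_form_linear i w c a b : cdom (F' i) w ->
  slope_form i (F' i w) (c *: a + b) = c *: slope_form i (F' i w) a + slope_form i (F' i w) b.
Proof.
move=> iw; have Bw : B i (F' i w) by exists w.
have dC := smooth_on_diff (covariant_slope_basic i).1 Bw.
have lP : lsubmx (c *: a + b) = c *: lsubmx a + lsubmx b by exact: linearP.
rewrite /slope_form (derive_x_linear _ _ _ dC) lP base_proj_chart.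
rewrite (christoffel_linear hH iw).
move: ('D_(row_mx 0 a) _ _) ('D_(row_mx 0 b) _ _) (covariant_slope i _) => d1 d2 C.
rewrite mulmxDr mulmxDl -scalemxAr -scalemxAl.
move: (C *m _) (C *m _) (_ *m C) (_ *m C) => u1 u2 u3 u4.
by apply/matrixP => r r'; rewrite !mxE; ring.
Qed.

(** A vector on which all three components vanish has no horizontal part; then
    its value part vanishes, and finally its slope part. *)
Lemma sasaki_spd i w : cdom (F' i) w -> spd (sasaki i (F' i w)).
Proof.
move=> iw; have sG := metric_spd hH iw.
apply: pform_spd => [c a b|c a b|c a b||a].
- exact: linearP.
- exact: value_form_linear.
- exact: slope_form_linear.
- by rewrite base_proj_chart.
rewrite /value_form /slope_form => a0; rewrite a0 base_proj_chart.
have g0 : christoffel (H := H) i (F i (projT1 w)) 0 = 0.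
  have := christoffel_linear hH iw (-1) 0 0.
  by rewrite scaler0 addr0 scaleN1r addNr.
rewrite g0 !mulmx0 mul0mx subr0 !addr0 => v0.
have bD : base_proj (row_mx 0 a : 'rV[R]_(k + (q + m))) = 0.
  by rewrite /base_proj row_mxKl row_mxKr a0 row_mx0.
have fD : fiber_proj (row_mx 0 a : 'rV[R]_(k + (q + m))) = rsubmx a.
  by rewrite /fiber_proj row_mxKr.
have Bw : B i (F' i w) by exists w.
have oB := @domain_open i.
have dS : differentiable slope_at (F' i w).
  exact: smooth_on_diff (slope_at_basic oB).1 Bw.
(* In a vertical direction that fixes the value, the Christoffel term of the
   covariant slope is constant. *)
have Sc h : covariant_slope i (h *: row_mx 0 a + F' i w) - slope_at (h *: row_mx 0 a + F' i w) =
    covariant_slope i (F' i w) - slope_at (F' i w).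
  have e1 : base_proj (h *: row_mx 0 a + F' i w) = base_proj (F' i w).
    by rewrite linearP /= bD scaler0 add0r.
  have e2 : value_at (h *: row_mx 0 a + F' i w) = value_at (F' i w).
    by rewrite /value_at linearP /= linearP /= fD v0 scaler0 add0r.
  by rewrite /covariant_slope e1 e2 !(addrC (slope_at _)) !addrK.
have D0 := @derive_along_cst _ _ _ (fun Z => covariant_slope i Z - slope_at Z) _ _ Sc.
have dC := smooth_on_diff (covariant_slope_basic i).1 Bw.
have dSv : derivable slope_at (F' i w) (row_mx 0 a) by exact: diff_derivable.
have dCv : derivable (covariant_slope i) (F' i w) (row_mx 0 a) by exact: diff_derivable.
have eD : 'D_(row_mx 0 a) (covariant_slope i) (F' i w) = jet_slope (rsubmx a).
  have := deriveB dCv dSv; rewrite [LHS]D0 => /esym /eqP; rewrite subr_eq0 => /eqP ->.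
  have df := differentiable_linear_mx (fiber_proj : {linear _ -> 'rV[R]_m}) (F' i w).
  apply: etrans (derive_linear_comp jet_slope _ df) _.
  by rewrite derive_linear_mx /= fD.
rewrite eD => s0.
by rewrite -[a]hsubmxK a0 (jet_value_slope_inj v0 s0) row_mx0.
Qed.

(** The rules [X_j = X_i J] and [J A_j = A_i J] are differentiated; the
    derivatives of [J] that appear are absorbed by the change of the
    Christoffel forms. *)
Lemma sasaki_transition i j w : cdom (F' i) w -> cdom (F' j) w ->
  sasaki i (F' i w) = tjac_transition (F := F') i j (F' i w) *m sasaki j (F' j w) *m
    (tjac_transition (F := F') i j (F' i w))^T.
Proof.
move=> iw jw; pose p := projT1 w.
have ip : cdom (F i) p by []; have jp : cdom (F j) p by [].
set J' := tjac_transition (F := F') i j (F' i w).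
set J := tjac_transition i j (F i p).
pose A := chart_img (F := F') i (cdom (F' i) `&` cdom (F' j)).
have oA : open A by exact: (chart_img2_open hF').
have Aw : A (F' i w) by exists w.
have Bj : B j (F' j w) by exists w.
have ft := transition_foliated hF' i j.
have AB Z : A Z -> B j (transition (F := F') i j Z).
  by move=> [w' [iw' jw'] <-]; rewrite (transitionE hF' j iw'); exists w'.
have AiB : A `<=` B i by move=> _ [w' [iw' jw'] <-]; exists w'.
have [ev es] := jet_transition hF (projT2 w) ip jp.
have eC w' : cdom (F' i) w' -> cdom (F' j) w' ->
    tjac_transition i j (F i (projT1 w')) *m covariant_slope j (F' j w') =
    covariant_slope i (F' i w') *m tjac_transition i j (F i (projT1 w')).
  move=> iw' jw'; have [ev' es'] := jet_transition hF (projT2 w') iw' jw'.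
  have ch := christoffel_transition hF hH (jet_value (triv i (projT2 w'))) iw' jw'.
  cbv zeta in ch; rewrite (covariant_slopeE iw') (covariant_slopeE jw') ev'; move: es' ch.
  move: (christoffel (H := H) i _ _) (christoffel (H := H) j _ _) => gi gj.
  move: (djac _ _ _ _) (tjac_transition _ _ _) => dd J0 es' ch.
  by rewrite mulmxDr es' mulmxDl ch -addrA (addrC dd).
have J'l a : lsubmx (a *m J') = lsubmx a *m J.
  by rewrite -{1}[a]hsubmxK (lifted_tjac hF hE _ _ iw jw) row_mxKl.
have bJ : basic_smooth A (fun Z => tjac_transition i j (base_proj Z)).
  have oI : open (chart_img i (cdom (F i) `&` cdom (F j))) by exact: chart_img2_open.
  have fb : foliated_map A (@base_proj R k q m) by exact: base_proj_foliated.
  apply: (basic_smooth_comp oA oI _ (tjac_transition_basic hF i j) fb).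
  by move=> _ [w' [iw' jw'] <-]; rewrite base_proj_chart; exists (projT1 w').
have dJ := smooth_on_diff bJ.1 Aw.
have DJ a : 'D_(row_mx 0 a) (fun Z => tjac_transition i j (base_proj Z)) (F' i w) =
    djac i j (F i p) (lsubmx a).
  have dt : differentiable (tjac_transition i j) (base_proj (F' i w)).
    rewrite base_proj_chart; apply: smooth_on_diff (tjac_transition_basic hF i j).1 _.
    by exists p.
  have db := differentiable_linear_mx
    (base_proj : {linear 'rV[R]_(k + (q + m)) -> 'rV[R]_(k + q)}) (F' i w).
  apply: etrans (derive_comp _ dt db) _.
  rewrite derive_linear_mx /= base_proj_chart /djac.
  by rewrite {1}/base_proj row_mxKl row_mxKr.
have chain (T : normedModType R) (f : 'rV[R]_(k + (q + m)) -> T) a : basic_smooth (B j) f ->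
    'D_(row_mx 0 a) (fun Z => f (transition (F := F') i j Z)) (F' i w) =
    'D_(row_mx 0 (a *m J')) f (F' j w).
  move=> bf; apply: etrans (derive_basic_comp _ AB bf ft Aw) _.
  by rewrite (row_mxKr (0 : 'rV[R]_k) a) (transitionE hF' j iw).
have ew' w' : cdom (F' i) w' -> value_at (F' i w') = jet_value (triv i (projT2 w')).
  by move=> _; rewrite /value_at lifted_chartE fiber_proj_coord.
have ewj w' : cdom (F' j) w' -> value_at (F' j w') = jet_value (triv j (projT2 w')).
  by move=> _; rewrite /value_at lifted_chartE fiber_proj_coord.
have evw : value_at (F' j w) = value_at (F' i w) *m J by rewrite (ew' _ iw) (ewj _ jw).
have Jv a : value_form j (F' j w) (a *m J') = value_form i (F' i w) a *m J.
  have dv := smooth_on_diff (value_at_basic oA).1 Aw.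
  have Dv Z b : 'D_(row_mx 0 b) value_at Z = jet_value (rsubmx b).
    have df := differentiable_linear_mx (fiber_proj : {linear _ -> 'rV[R]_m}) Z.
    apply: etrans (derive_linear_comp jet_value _ df) _.
    by rewrite derive_linear_mx /= /fiber_proj row_mxKr.
  have e Z : A Z -> value_at (transition (F := F') i j Z) =
      value_at Z *m tjac_transition i j (base_proj Z).
    move=> [w' [iw' jw'] <-].
    rewrite (transitionE hF' j iw') base_proj_chart (ew' _ iw') (ewj _ jw').
    exact: (jet_transition hF (projT2 w') iw' jw').1.
  have E1 : jet_value (rsubmx (a *m J')) =
      jet_value (rsubmx a) *m J + value_at (F' i w) *m djac i j (F i p) (lsubmx a).
    apply: etrans (esym (Dv (F' j w) _)) _.
    apply: etrans (esym (chain _ _ a (value_at_basic (@domain_open j)))) _.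
    apply: etrans (derive_ext _ oA e Aw) _.
    apply: etrans (derive_mulmx _ dv dJ) _.
    by rewrite Dv DJ base_proj_chart.
  rewrite /value_form E1 J'l evw !base_proj_chart mulmxDl -addrA; congr (_ + _).
  have E3 := christoffel_transition hF hH (lsubmx a) ip jp; cbv zeta in E3; rewrite -/J in E3.
  by rewrite -[RHS]mulmxA E3 mulmxDr mulmxA addrC.
have JA a : J *m slope_form j (F' j w) (a *m J') = slope_form i (F' i w) a *m J.
  have dCi := smooth_on_diff (covariant_slope_basic i).1 (AiB _ Aw).
  have bCt : basic_smooth A (fun Z => covariant_slope j (transition (F := F') i j Z)).
    exact: (basic_smooth_comp oA (@domain_open j) AB (covariant_slope_basic j) ft).
  have dCt := smooth_on_diff bCt.1 Aw.
  have e Z : A Z ->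
      tjac_transition i j (base_proj Z) *m covariant_slope j (transition (F := F') i j Z) =
      covariant_slope i Z *m tjac_transition i j (base_proj Z).
    by move=> [w' [iw' jw'] <-]; rewrite (transitionE hF' j iw') base_proj_chart; exact: eC.
  have E1 : djac i j (F i p) (lsubmx a) *m covariant_slope j (F' j w) +
      J *m 'D_(row_mx 0 (a *m J')) (covariant_slope j) (F' j w) =
      'D_(row_mx 0 a) (covariant_slope i) (F' i w) *m J +
      covariant_slope i (F' i w) *m djac i j (F i p) (lsubmx a).
    have := derive_ext (row_mx 0 a) oA e Aw.
    rewrite (derive_mulmx _ dJ dCt) (derive_mulmx _ dCi dJ) DJ chain; last first.
      exact: covariant_slope_basic.
    by rewrite (transitionE hF' j iw) base_proj_chart.
  have E2 := eC w iw jw; rewrite -/p -/J in E2.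
  have E3 := christoffel_transition hF hH (lsubmx a) ip jp; cbv zeta in E3; rewrite -/J in E3.
  rewrite /slope_form J'l !base_proj_chart -/p.
  exact: (conjugate_derivation E1 E2 E3).
have uJ : J \in unitmx by exact: (tjac_transition_unit hF ip jp).
have sGi := metric_spd hH ip; have sGj := metric_spd hH jp.
have pE i' a b : cdom (F' i') w -> (a *m sasaki i' (F' i' w) *m b^T) 0 0 =
    pform (@lsubmx R 1 q m) (value_form i' (F' i' w)) (slope_form i' (F' i' w))
      (H i' (F i' p)) a b.
  move=> iw'; rewrite /sasaki base_proj_chart; apply: pform_mxE.
  - by move=> *; exact: linearP.
  - by move=> *; exact: value_form_linear.
  - by move=> *; exact: slope_form_linear.
  - exact: metric_spd.
apply: form_eq => a b; rewrite (pE i _ _ iw).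
have -> : a *m (J' *m sasaki j (F' j w) *m J'^T) *m b^T =
    (a *m J') *m sasaki j (F' j w) *m (b *m J')^T by rewrite trmx_mul !mulmxA.
rewrite (pE j _ _ jw) /pform (J'l a) (J'l b) (Jv a) (Jv b).
exact: (@sform_change_frame _ _ _ _ _ _ _ _ _ _ _ _ _ (spd_unit sGj) uJ
  (metric_transition hH ip jp) (JA a) (JA b)).
Qed.

Lemma sasaki_basic i : basic_smooth (B i) (sasaki i).
Proof.
have oB := @domain_open i.
have bC a : basic_smooth (B i) (fun Z => christoffel (H := H) i (base_proj Z) (lsubmx a)).
  exact: (basic_on_domain (christoffel_basic hF hH i (lsubmx a))).
have bdv a : basic_smooth (B i) (fun Z => value_form i Z a).
  apply: basic_smoothD => //; first exact: basic_smooth_cst.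
  by apply: basic_smooth_mulmx => //; exact: value_at_basic.
have bdc a : basic_smooth (B i) (fun Z => slope_form i Z a).
  apply: basic_smoothD => //; first exact: (basic_smooth_derive _ oB (covariant_slope_basic i)).
  apply: basic_smoothD => //.
    by apply: basic_smooth_mulmx => //; exact: covariant_slope_basic.
  apply: (@basic_smooth_linear _ _ _ _ _ _ _ -%R) => //.
  by apply: basic_smooth_mulmx => //; exact: covariant_slope_basic.
have bG : basic_smooth (B i) (fun Z => H i (base_proj Z)) by apply: basic_on_domain; case: hH.
have bI : basic_smooth (B i) (fun Z => invmx (H i (base_proj Z))).
  apply: basic_smooth_invmx => // Z /base_proj_domain [p ip <-].
  by apply: spd_unit; exact: metric_spd.
have bT r c (f : _ -> 'M[R]_(r, c)) : basic_smooth (B i) f ->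
    basic_smooth (B i) (fun Z => (f Z)^T).
  by move=> bf; exact: (@basic_smooth_linear _ _ _ _ _ _ _ trmx _ _ oB bf).
apply/basic_smooth_mxP => // l l'; under eq_fun do rewrite mxE.
rewrite /pform /sform.
have b1 (u v : 'rV[R]_q) : basic_smooth (B i) (fun Z => u *m H i (base_proj Z) *m v^T).
  have bc r c (K : 'M[R]_(r, c)) : basic_smooth (B i) (fun=> K).
    exact: basic_smooth_cst.
  exact: basic_smooth_mulmx oB (basic_smooth_mulmx oB (bc _ _ _) bG) (bc _ _ _).
have b2 : basic_smooth (B i) (fun Z => value_form i Z (delta_mx 0 l) *m H i (base_proj Z) *m
    (value_form i Z (delta_mx 0 l'))^T).
  exact: basic_smooth_mulmx oB (basic_smooth_mulmx oB (bdv _) bG) (bT _ _ _ (bdv _)).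
have b3 : basic_smooth (B i) (fun Z =>
    invmx (H i (base_proj Z)) *m slope_form i Z (delta_mx 0 l) *m
    H i (base_proj Z) *m (slope_form i Z (delta_mx 0 l'))^T).
  apply: (basic_smooth_mulmx oB _ (bT _ _ _ (bdc _))).
  exact: basic_smooth_mulmx oB (basic_smooth_mulmx oB bI (bdc _)) bG.
apply: basic_smoothD => //; first apply: basic_smoothD => //.
- have /(basic_smooth_mxP _ oB) := b1 (lsubmx (delta_mx 0 l)) (lsubmx (delta_mx 0 l')).
  exact.
- by have /(basic_smooth_mxP _ oB) := b2; exact.
apply: basic_smooth_sum => // c.
by have /(basic_smooth_mxP _ oB) := b3; exact.
Qed.

Lemma sasaki_riemannian : riemannian F'.
Proof.
apply/(riemannianP hF'); exists sasaki; split=> [i|i w iw|i j w iw jw].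
- exact: sasaki_basic.
- exact: sasaki_spd.
- exact: sasaki_transition.
Qed.

End SasakiMetric.

Theorem theorem1p1 (R : realType) (M : topologicalType) (k q : nat)
    (A : atlas R M (k + q)) (F : fatlas R M k q)
    (hM : smooth_manifold A) (hF : foliation A F) :
  (exists r : nat, (1 <= r)%N /\
     riemannian (lifted_foliation (jet_bundle (normal_bundle F) r)))
  <-> riemannian F.
Proof.
have hF0 : foliated_atlas F by case: hF.
split=> [[r [_ rF']]|rF].
  apply: riemannian_of_lifted rF' => //.
  exact/jet_bundle_foliated/normal_bundle_foliated.
exists 1%N; split=> //; have [H hH] := (riemannianP hF0).1 rF.
exact: sasaki_riemannian hH.
Qed.
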